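(* Let $I_1,\ldots,I_n$ be $\mathfrak m$-primary ideals of $R$. (1) For every sufficiently large integer $m>0$ there exists a nonempty Zariski open subset $\mathcal U_m\subset I_1^{(m)}\times\cdots\times I_n^{(m)}$ such that for every $(f_1,\ldots,f_n)\in\mathcal U_m$ the origin $o$ is an isolated root of $f_1=\cdots=f_n=0$ and the multiplicity $e_o(f_1,\ldots,f_n)$ is the same. (2) Moreover, this common value is the smallest multiplicity $e_o(g_1,\ldots,g_n)$ among all systems $(g_1,\ldots,g_n)\in I_1^{(m)}\times\cdots\times I_n^{(m)}$ having $o$ as an isolated root.
   Context: $\mathbf{k}$ is algebraically closed; $X\subset\mathbb{A}^N$ is an affine variety over $\mathbf k$ (possibly reducible) whose irreducible components all have dimension $n$, containing the origin $o$; $R=\mathcal O_{X,o}$ with maximal ideal $\mathfrak m$; $\mathfrak m$-primary means containing some $\mathfrak m^r$. $A^{(m)}\subset R$ is the set of restrictions to $X$ of polynomials in $\mathbf k[x_1,\ldots,x_N]$ of degree $\le m$, and $I^{(m)}=A^{(m)}\cap I$. For $f_1,\ldots,f_n\in R$ with $o$ an isolated common zero (i.e. the ideal $I_{\mathbf f}$ they generate is $\mathfrak m$-primary), the multiplicity is $e_o(f_1,\ldots,f_n)=n!\lim_{k\to\infty}\dim_{\mathbf k}(R/I_{\mathbf f}^k)/k^n$. *)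

(* Defs.v *)
From Stdlib Require Import Rdefinitions Raxioms RIneq Rpow_def Rfunctions Rseries ClassicalEpsilon.
From HB Require Import structures.
From mathcomp Require Import all_boot all_order all_algebra.
From mathcomp Require Import mpoly.

Set Implicit Arguments.
Unset Strict Implicit.
Unset Printing Implicit Defensive.

Import GRing.Theory.
Local Open Scope ring_scope.

Section AffineLocal.
Context (k : closedFieldType) (N : nat).

Definition kpoly := {mpoly k[N]}.
Definition point := 'I_N -> k.
Definition origin : point := fun _ => 0.

Definition aset := point -> Prop.
Definition asubset (A B : aset) := forall x, A x -> B x.
Definition aeq (A B : aset) := asubset A B /\ asubset B A.

Definition zclosed (Z : aset) :=
  exists S : kpoly -> Prop, forall x, Z x <-> (forall p, S p -> p.@[x] = 0).

Definition irreducible (Y : aset) :=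
  zclosed Y /\ (exists x, Y x) /\
  forall Z1 Z2, zclosed Z1 -> zclosed Z2 ->
    asubset Y (fun x => Z1 x \/ Z2 x) -> asubset Y Z1 \/ asubset Y Z2.

Definition irr_component (X Y : aset) :=
  irreducible Y /\ asubset Y X /\
  forall Y', irreducible Y' -> asubset Y Y' -> asubset Y' X -> asubset Y' Y.

Definition irr_chain (Y : aset) (d : nat) (c : nat -> aset) :=
  (forall i, (i <= d)%N -> irreducible (c i) /\ asubset (c i) Y) /\
  (forall i, (i < d)%N -> asubset (c i) (c i.+1) /\ ~ asubset (c i.+1) (c i)).

Definition dim_eq (Y : aset) (n : nat) :=
  (exists c, irr_chain Y n c) /\ ~ (exists c, irr_chain Y n.+1 c).

Definition equidim_variety_at0 (X : aset) (n : nat) :=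
  zclosed X /\ X origin /\ forall Y, irr_component X Y -> dim_eq Y n.

Definition vanish (X : aset) (p : kpoly) := forall x, X x -> p.@[x] = 0.

(* an element of R is represented by a fraction a/b with b(o) <> 0 *)
Definition germ := (kpoly * kpoly)%type.
Definition isR (u : germ) := u.2.@[origin] != 0.
(* equality in R = k[x]_M / I(X)_M *)
Definition Req (X : aset) (u v : germ) :=
  exists h : kpoly, h.@[origin] != 0 /\ vanish X (h * (u.1 * v.2 - v.1 * u.2)).

Definition fadd (u v : germ) : germ := (u.1 * v.2 + v.1 * u.2, u.2 * v.2).
Definition fmul (u v : germ) : germ := (u.1 * v.1, u.2 * v.2).
Definition fscale (c : k) (u : germ) : germ := (c *: u.1, u.2).
Definition fzero : germ := (0, 1).
Definition fpoly (p : kpoly) : germ := (p, 1).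

(* ideals of R, as predicates on representatives closed under Req *)
Definition Rideal (X : aset) (I : germ -> Prop) :=
  (forall u, I u -> isR u) /\ I fzero /\
  (forall u v, I u -> I v -> I (fadd u v)) /\
  (forall r u, isR r -> I u -> I (fmul r u)) /\
  (forall u v, I u -> isR v -> Req X u v -> I v).

Definition Rgen (X : aset) (S : germ -> Prop) : germ -> Prop :=
  fun u => forall I, Rideal X I -> (forall v, S v -> I v) -> I u.

Definition Rprod (X : aset) (I J : germ -> Prop) : germ -> Prop :=
  Rgen X (fun w => exists u v, I u /\ J v /\ w = fmul u v).

Fixpoint Rpow (X : aset) (I : germ -> Prop) (r : nat) : germ -> Prop :=
  match r with
  | 0 => isR
  | r'.+1 => Rprod X (Rpow X I r') I
  end.

Definition Rmax : germ -> Prop := fun u => isR u /\ u.1.@[origin] = 0.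

Definition mprimary (X : aset) (I : germ -> Prop) :=
  Rideal X I /\ exists r, forall u, Rpow X Rmax r u -> I u.

Fixpoint fsum (s : seq germ) : germ :=
  if s is u :: s' then fadd u (fsum s') else fzero.

Definition lincomb (d : nat) (c : 'I_d -> k) (e : 'I_d -> germ) : germ :=
  fsum [seq fscale (c j) (e j) | j <- enum 'I_d].

Definition fsub (u v : germ) : germ := fadd u (fscale (-1) v).

Definition quot_dim (X : aset) (I : germ -> Prop) (d : nat) :=
  exists e : 'I_d -> germ,
    (forall j, isR (e j)) /\
    (forall c, I (lincomb c e) -> forall j, c j = 0) /\
    (forall u, isR u -> exists c, I (fsub u (lincomb c e))).

(* the dimension (meaningful when finite) *)
Definition qdim (X : aset) (I : germ -> Prop) : nat :=
  epsilon (inhabits 0%N) (quot_dim X I).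

Definition sys_ideal (X : aset) (n : nat) (f : 'I_n -> kpoly) : germ -> Prop :=
  Rgen X (fun u => exists i, u = fpoly (f i)).

Definition isolated_root (X : aset) (n : nat) (f : 'I_n -> kpoly) :=
  mprimary X (sys_ideal X f).

Definition mult_is (X : aset) (n : nat) (f : 'I_n -> kpoly) (e : R) :=
  Un_cv (fun j => Rdiv (Rmult (INR (factorial n)) (INR (qdim X (Rpow X (sys_ideal X f) j))))
                       (Rpow_def.pow (INR j) n)) e.

Definition deg_part (I : germ -> Prop) (m : nat) (p : kpoly) :=
  (msize p <= m.+1)%N /\ I (fpoly p).

Definition sys_space (n : nat) (I : 'I_n -> germ -> Prop) (m : nat)
  (f : 'I_n -> kpoly) := forall i, deg_part (I i) m (f i).

Definition coef_index (n m : nat) := ('I_n * 'X_{1..N < m.+1})%type.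
Definition coords (n m : nat) (f : 'I_n -> kpoly) :
  'I_#|{: coef_index n m}| -> k :=
  fun j => let ij := enum_val j in (f ij.1)@_(val ij.2).

Definition zopen_in (n m : nat) (V U : ('I_n -> kpoly) -> Prop) :=
  exists hs : seq {mpoly k[#|{: coef_index n m}|]},
    forall f, U f <-> (V f /\ has (fun h => h.@[@coords n m f] != 0) hs).

(* U only depends on the restrictions of the f_i to X (so it is a subset of
   I_1^(m) x ... x I_n^(m) viewed as a space of functions on X) *)
Definition restr_saturated (X : aset) (n : nat) (V U : ('I_n -> kpoly) -> Prop) :=
  forall f g, U f -> V g -> (forall i, Req X (fpoly (f i)) (fpoly (g i))) -> U g.

End AffineLocal.

(* Main.v *)
Require Import Defs.
From Stdlib Require Import Rdefinitions Raxioms.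
From Stdlib Require RIneq Rfunctions Rseries SeqProp Lra.
From Stdlib Require Import Classical ClassicalEpsilon.
From mathcomp Require boolp classical_sets.
From HB Require Import structures.
From mathcomp Require Import all_boot all_order all_algebra.
From mathcomp Require Import mpoly zify ring.

(** The multiplicity of a system [f] with isolated root is a rank. Let [I] be the
    ideal of [R] generated by [f_1, ..., f_n], and [b_1, ..., b_d] a basis of
    [R / I]. The graded ring [gr_I R] is generated by the [b_i] over
    [k[T_1, ..., T_n]]; let [r] be its rank. A maximal free subfamily of the [b_i]
    bounds [dim R / I^K] from below by [r] times the number of monomials of degree
    [< K], and one homogeneous relation for each remaining [b_i], rewriting by
    its leading monomial, bounds it from above by the same number plus
    [O(K^(n-1))]. So the limit exists and equals [r]. The same rewriting gives
    Lech's formula: [r K^n <= dim R / (f_1^K, ..., f_n^K) <= r K^n + O(K^(n-1))].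

    Let [g] have minimal [r]. For [K] large, [dim R / (g^K) < (r + 1) K^n]. The bound
    [dim R / (f^K) <= dim R / (g^K)] follows from the non-vanishing of a minor
    of a matrix of coordinates in [R / m^(s+1)], and by Nakayama's lemma it
    also makes [o] an isolated root of [f]. On this open set the multiplicity
    is at most [r], hence equal to [r].

    A system with isolated root exists: a Noether normalization [y_1, ..., y_d] of
    the coordinate ring of [X] has [d <= n], because going up produces a chain
    of [d + 1] irreducible closed subsets of [X]; powers of the
    [y_i - y_i(o)] then lie in the given ideals. *)

Set Implicit Arguments.
Unset Strict Implicit.
Unset Printing Implicit Defensive.

Import GRing.Theory.
Local Open Scope ring_scope.

(** * Linear algebra modulo a subspace *)

Section Codimension.
Context (k : fieldType) (E : lmodType k).
Implicit Types A : E -> Prop.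

(** The multiplicity is a limit, while an open condition sees only finitely many algebraic
    conditions on the coefficients. The asymmetry of Lech's formula bridges the gap: its lower bound
    [r * K ^ n] has no error term and holds for every positive [K]. For [f] one exponent [K] is
    therefore enough, and the error constant of [f], which varies with [f], never enters; [K] is
    chosen from the constant of the fixed minimal system [g] alone. A second obstacle is that
    isolation of the root must itself be detected at finite order. A quotient of dimension at most
    [L] cannot drop strictly [L + 1] times along the powers of [m], so the colength [L] of [(g^K)]
    makes the order [L + 1] sufficient. Error terms [O(K^(n-1))] appear as [C * K ^ n] in
    inequalities multiplied by [K], which treats [n = 0] uniformly. *)

Definition subspace A :=
  [/\ A 0, forall u v, A u -> A v -> A (u + v) & forall c u, A u -> A (c *: u)].

Definition spans A (J : finType) (e : J -> E) :=
  forall p, exists c : J -> k, A (p - \sum_j c j *: e j).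

Definition indep A (J : finType) (e : J -> E) :=
  forall c : J -> k, A (\sum_j c j *: e j) -> forall j, c j = 0.

Lemma subspaceN A u : subspace A -> A u -> A (- u).
Proof. by case=> _ _ HZ Au; rewrite -scaleN1r; apply: HZ. Qed.

Lemma subspaceB A u v : subspace A -> A u -> A v -> A (u - v).
Proof. by move=> HA Au Av; case: (HA) => _ HD _; apply: HD => //; apply: subspaceN. Qed.

Lemma subspace_sum A (J : Type) (r : seq J) (P : pred J) (F : J -> E) :
  subspace A -> (forall j, P j -> A (F j)) -> A (\sum_(j <- r | P j) F j).
Proof. by case=> H0 HD _ HF; apply: (big_ind A). Qed.

Lemma subspace_iff A u v : subspace A -> A (u - v) -> A v -> A u.
Proof. by case=> _ HD _ Auv Av; rewrite -(subrK v u); apply: HD. Qed.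

Lemma indep_le_spans A (J J' : finType) (e : J -> E) (e' : J' -> E) :
  subspace A -> spans A e -> indep A e' -> (#|J'| <= #|J|)%N.
Proof.
move=> HA He He'; rewrite leqNgt; apply/negP => ltJ.
have [c Hc] : exists c : J' -> J -> k, forall i, A (e' i - \sum_j c i j *: e j).
  exists (fun i => epsilon (inhabits (fun _ => 0)) (fun c => A (e' i - \sum_j c j *: e j))).
  by move=> i; apply: epsilon_spec (He (e' i)).
pose C := \matrix_(i < #|J'|, j < #|J|) c (enum_val i) (enum_val j).
have : kermx C != 0.
  rewrite -mxrank_eq0 mxrank_ker subn_eq0 -ltnNge.
  by apply: leq_ltn_trans (rank_leq_col C) ltJ.
case/rowV0Pn=> u /sub_kermxP uC u0.
move/eqP: u0; apply; apply/rowP => i; rewrite mxE.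
rewrite -(He' (fun j => u 0 (enum_rank j)) _ (enum_val i)) ?enum_valK //.
apply: (@subspace_iff _ _ (\sum_i u 0 (enum_rank i) *: \sum_j c i j *: e j)) => //.
  rewrite -sumrB; apply: subspace_sum => // j _; rewrite -scalerBr.
  by case: HA => _ _; apply; apply: Hc.
under eq_bigr do rewrite scaler_sumr.
rewrite exchange_big /= big1 => [|j _]; first by case: HA.
under eq_bigr do rewrite scalerA.
rewrite -scaler_suml.
have -> : \sum_i0 u 0 (enum_rank i0) * c i0 j = (u *m C) 0 (enum_rank j).
  rewrite mxE (reindex (@enum_val J' predT)) /=; last exact: (onW_bij _ (enum_val_bij J')).
  by apply: eq_bigr => a _; rewrite enum_valK mxE enum_rankK.
by rewrite uC mxE scale0r.
Qed.

Lemma spans_sub A B (J : finType) (e : J -> E) :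
  (forall u, A u -> B u) -> spans A e -> spans B e.
Proof. by move=> AB He p; have [c Hc] := He p; exists c; apply: AB. Qed.

Lemma spans_enum A (J : finType) (e : J -> E) :
  spans A e -> spans A (fun i : 'I_#|J| => e (enum_val i)).
Proof.
move=> He p; have [c Hc] := He p; exists (fun i : 'I_#|J| => c (enum_val i)).
rewrite (reindex (@enum_val J predT)) in Hc => //.
exact: (onW_bij _ (enum_val_bij J)).
Qed.

Lemma spans_drop A d (e : 'I_d.+1 -> E) (c : 'I_d.+1 -> k) j :
  subspace A -> spans A e -> A (\sum_i c i *: e i) -> c j != 0 ->
  spans A (fun i : 'I_d => e (lift j i)).
Proof.
move=> HA He Hc cj p; have [b Hb] := He p.
exists (fun i => b (lift j i) - b j / c j * c (lift j i)).
have -> : p - \sum_j0 (b (lift j j0) - b j / c j * c (lift j j0)) *: e (lift j j0)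
  = (p - \sum_i b i *: e i) + (b j / c j) *: \sum_i c i *: e i; last first.
  by case: (HA) => _ HD HZ; apply: HD => //; apply: HZ.
rewrite !(bigD1_ord j) //= scalerDr scalerA divfK // opprD addrA.
rewrite [- (b j *: _) - _]addrC -!addrA [- (b j *: _) + _]addrA addNr add0r; congr (_ + _).
rewrite scaler_sumr -!sumrN -big_split /=; apply: eq_bigr => i _.
by rewrite scalerBl opprB scalerA addrC.
Qed.

Lemma spans_basis A (J : finType) (e : J -> E) : subspace A -> spans A e ->
  exists d (b : 'I_d -> E), [/\ (d <= #|J|)%N, spans A b & indep A b].
Proof.
move=> HA /spans_enum; set b0 := fun i => _; move: b0; move: #|J| => d b.
elim: d b => [|d IH] b Hb.
  by exists 0%N, b; split=> // c _ [].
have [Hi|Hi] := classic (indep A b); first by exists d.+1, b.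
have [c Hc'] := not_all_ex_not _ _ Hi; have [Hc /not_all_ex_not] := imply_to_and _ _ Hc'.
case=> j /eqP cj.
have [d' [b' [le sb ib]]] := IH _ (spans_drop HA Hb Hc cj).
by exists d', b'; split=> //; apply: leqW.
Qed.

End Codimension.

(** * Ideals of the local ring as saturated ideals of polynomials *)

Lemma meval_mpoly0 (k : closedFieldType) N (p : {mpoly k[N]}) :
  p.@[@origin _ _] = p@_0%MM.
Proof.
rewrite -{1}[p](subrK (p@_0)%:MP) mevalD mevalC -[RHS]add0r; congr (_ + _).
rewrite mevalE big_seq big1 // => m; rewrite mcoeff_msupp mcoeffB mcoeffC.
have [->|m0 _] := eqVneq m 0%MM; first by rewrite mulr1 subrr eqxx.
have /existsP[i mi] : [exists i, m i != 0%N].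
  rewrite -negb_forall; apply: contra m0 => /forallP H.
  by apply/eqP/mnmP => i; rewrite mnm0E; apply/eqP.
by rewrite (bigD1 i) //= expr0n (negbTE mi) mul0r mulr0.
Qed.

Section LocalIdeals.
Context (k : closedFieldType) (N : nat) (X : aset k N).
Local Notation S := {mpoly k[N]}.
Local Notation xv := (fun i : 'I_N => 'X_i : S).
Implicit Types (p q h : S) (A B : S -> Prop).

Lemma vanish0 : vanish X (0 : S).
Proof. by move=> x _; rewrite meval0. Qed.

Lemma vanishD p q : vanish X p -> vanish X q -> vanish X (p + q).
Proof. by move=> Hp Hq x Xx; rewrite mevalD Hp ?Hq ?addr0. Qed.

Lemma vanishM p q : vanish X q -> vanish X (p * q).
Proof. by move=> Hq x Xx; rewrite mevalM Hq ?mulr0. Qed.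

Lemma vanishN p : vanish X p -> vanish X (- p).
Proof. by move=> Hp; rewrite -mulN1r; apply: vanishM. Qed.

(* The contractions to [k[x]] of the ideals of [R]: ideals containing [I(X)]
   and saturated with respect to the polynomials not vanishing at the origin. *)
Definition lideal A :=
  [/\ forall p, vanish X p -> A p,
      forall p q, A p -> A q -> A (p + q),
      forall p q, A q -> A (p * q) &
      forall h p, h.@[@origin _ _] != 0 -> A (h * p) -> A p].

Lemma lideal_subspace A : lideal A -> subspace A.
Proof.
case=> H1 H2 H3 _; split=> //; first by apply: H1; apply: vanish0.
by move=> c u Au; rewrite -mul_mpolyC; apply: H3.
Qed.

Lemma lidealM A p q : lideal A -> A q -> A (p * q).
Proof. by case=> _ _ H _; apply: H. Qed.

Lemma lidealV A p : lideal A -> vanish X p -> A p.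
Proof. by case=> H _ _ _; apply: H. Qed.

Lemma lidealB A p q : lideal A -> A p -> A q -> A (p - q).
Proof. by move=> /lideal_subspace; apply: subspaceB. Qed.

Lemma lideal_sum A (J : Type) {r : seq J} (P : pred J) (F : J -> S) :
  lideal A -> (forall j, P j -> A (F j)) -> A (\sum_(j <- r | P j) F j).
Proof. by move=> /lideal_subspace; apply: subspace_sum. Qed.

Lemma lideal_iff A p q : lideal A -> A (p - q) -> A q -> A p.
Proof. by move=> /lideal_subspace; apply: subspace_iff. Qed.

Lemma lideal_unit A h p : lideal A -> h.@[@origin _ _] != 0 -> A (h * p) -> A p.
Proof. by case=> _ _ _; apply. Qed.

Lemma lideal_colon A g : lideal A -> lideal (fun p => A (p * g)).
Proof.
case=> H1 H2 H3 H4; split.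
- by move=> p Hp; apply: H1; rewrite mulrC; apply: vanishM.
- by move=> p q; rewrite mulrDl; apply: H2.
- by move=> p q; rewrite -mulrA; apply: H3.
- by move=> h p h0; rewrite -mulrA; apply: H4.
Qed.

(** The factor [h], a unit of [R], clears denominators, so that membership in an ideal of [R] is
    expressed by polynomials alone. *)
Definition lgen c B (f : 'I_c -> S) p :=
  exists2 h, h.@[@origin _ _] != 0 &
  exists2 q : 'I_c -> S, forall i, B (q i) & vanish X (h * p - \sum_i q i * f i).

(* [lpow f j] is the contraction of the [j]-th power of the ideal of [R]
   generated by [f]. *)
Fixpoint lpow c (f : 'I_c -> S) j : S -> Prop :=
  if j is j'.+1 then lgen (lpow f j') f else fun _ => True.

Lemma lgen_lideal c B (f : 'I_c -> S) :
  B 0 -> (forall p q, B p -> B q -> B (p + q)) -> (forall p q, B q -> B (p * q)) ->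
  lideal (lgen B f).
Proof.
move=> B0 BD BM; split.
- move=> p Hp; exists 1; first by rewrite meval1 oner_neq0.
  exists (fun _ => 0) => //; rewrite mul1r big1 ?subr0 // => i _; exact: mul0r.
- move=> p p' [h h0 [q Bq Hq]] [h' h0' [q' Bq' Hq']].
  exists (h * h'); first by rewrite mevalM mulf_neq0.
  exists (fun i => h' * q i + h * q' i) => [i|]; first by apply: BD; apply: BM.
  have -> : h * h' * (p + p') - \sum_i (h' * q i + h * q' i) * f i =
    h' * (h * p - \sum_i q i * f i) + h * (h' * p' - \sum_i q' i * f i).
    under eq_bigr do rewrite mulrDl -!mulrA.
    by rewrite big_split /= !mulrBr -!mulr_sumr !mulrDr; ring.
  by apply: vanishD; apply: vanishM.
- move=> g p [h h0 [q Bq Hq]]; exists h => //.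
  exists (fun i => g * q i) => [i|]; first exact: BM.
  have -> : h * (g * p) - \sum_i g * q i * f i = g * (h * p - \sum_i q i * f i).
    by under eq_bigr do rewrite -!mulrA; rewrite -mulr_sumr; ring.
  exact: vanishM.
- move=> g p g0 [h h0 [q Bq Hq]]; exists (h * g); first by rewrite mevalM mulf_neq0.
  by exists q => //; rewrite -mulrA.
Qed.

Lemma lpow_lideal c (f : 'I_c -> S) j : lideal (lpow f j).
Proof.
elim: j => [|j IH] //=; apply: lgen_lideal.
- exact: (lidealV IH vanish0).
- by case: IH.
- by case: IH.
Qed.
Hint Resolve lpow_lideal : core.

Lemma lpowS c (f : 'I_c -> S) j i p : lpow f j p -> lpow f j.+1 (p * f i).
Proof.
move=> Hp; exists 1; first by rewrite meval1 oner_neq0.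
exists (fun i' => if i' == i then p else 0) => [i'|].
  by case: ifP => // _; apply: (lidealV (lpow_lideal _ _) vanish0).
rewrite (bigD1 i) //= eqxx big1 => [|i' /negbTE ->]; last exact: mul0r.
rewrite mul1r addr0 subrr; exact: vanish0.
Qed.

Lemma lpow1 c (f : 'I_c -> S) i : lpow f 1 (f i).
Proof. by rewrite -[f i]mul1r; apply: lpowS. Qed.

Lemma lpow_decr1 c (f : 'I_c -> S) j p : lpow f j.+1 p -> lpow f j p.
Proof.
elim: j p => [|j IH] p //= [h h0 [q Hq Hp]]; exists h => //; exists q => // i.
exact/IH/Hq.
Qed.

Lemma lpow_decr c (f : 'I_c -> S) i j p : (i <= j)%N -> lpow f j p -> lpow f i p.
Proof.
move=> /subnK <-; elim: (j - i)%N => [//|t IH].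
by rewrite addSn => /lpow_decr1.
Qed.

Lemma lpow_step c (f : 'I_c -> S) j A : lideal A ->
  (forall i q, lpow f j q -> A (q * f i)) -> forall p, lpow f j.+1 p -> A p.
Proof.
move=> HA H p [h h0 [q Hq Hp]]; apply: (lideal_unit HA h0).
apply: (lideal_iff HA (lidealV HA Hp)); apply: lideal_sum => // i _; apply: H; exact: Hq.
Qed.

Lemma lpowM c (f : 'I_c -> S) i j p q :
  lpow f i p -> lpow f j q -> lpow f (i + j) (p * q).
Proof.
elim: j q => [|j IH] q Hp.
  by move=> _; rewrite addn0 mulrC; apply: lidealM.
move=> Hq; rewrite mulrC addnS.
apply: (lpow_step (lideal_colon _ (lpow_lideal f (i + j).+1)) _ Hq) => i' r Hr.
by rewrite mulrAC mulrC -mulrC; apply: lpowS; rewrite mulrC; apply: IH.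
Qed.

Lemma mmap1D c (f : 'I_c -> S) (m1 m2 : 'X_{1..c}) :
  mmap1 f (m1 + m2)%MM = mmap1 f m1 * mmap1 f m2.
Proof. by apply: commr_mmap1_M => i x; apply: mulrC. Qed.

Lemma mdegS_split c j (m : 'X_{1..c}) :
  mdeg m = j.+1 -> exists i m', m = (m' + U_(i))%MM /\ mdeg m' = j.
Proof.
move=> Hm; have /existsP[i mi] : [exists i, m i != 0%N].
  rewrite -negb_forall; apply/negP => /forallP H.
  have m0 : m = 0%MM by apply/mnmP => i; rewrite mnm0E; apply/eqP.
  by move: Hm; rewrite m0 mdeg0.
have E : m = ((m - U_(i)) + U_(i))%MM.
  by rewrite submK //; apply/mnm_lepP => l; rewrite mnm1E; case: eqP => // <-; rewrite lt0n.
exists i, (m - U_(i))%MM; split=> //.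
by move: Hm; rewrite {1}E mdegD mdeg1 addn1 => -[].
Qed.

(** The colon ideal of [A] by [f i] is again an [lideal], so the factors of a monomial can be moved
    into the ideal one at a time. *)
Lemma lpow_ind c (f : 'I_c -> S) j A : lideal A ->
  (forall m, mdeg m = j -> A (mmap1 f m)) -> forall p, lpow f j p -> A p.
Proof.
elim: j A => [|j IH] A HA H p.
  move=> _; rewrite -[p]mulr1; apply: lidealM => //.
  by rewrite -(mmap11 f); apply: H; rewrite mdeg0.
apply: lpow_step => // i; apply: IH; first exact: lideal_colon.
by move=> m Hm; rewrite -(mmap1U f i) -mmap1D; apply: H; rewrite mdegD Hm mdeg1 addn1.
Qed.

Lemma lpow_mon c (f : 'I_c -> S) m : lpow f (mdeg m) (mmap1 f m).
Proof.
move: {2}(mdeg m) (erefl (mdeg m)) => j; elim: j m => [|j IH] m Hm; rewrite ?Hm //.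
have [i [m' [-> Hm']]] := mdegS_split Hm.
by rewrite mmap1D mmap1U; apply: lpowS; rewrite -Hm'; apply: IH.
Qed.

Lemma lpow_exp c (f : 'I_c -> S) s j p : lpow f s p -> lpow f (s * j) (p ^+ j).
Proof.
move=> Hp; elim: j => [|j IH]; first by rewrite muln0.
by rewrite exprS mulnS; apply: lpowM.
Qed.

Lemma lpow_comp c d (f : 'I_c -> S) (g : 'I_d -> S) s :
  (forall p, lpow f s p -> lpow g 1 p) ->
  forall j p, lpow f (s * j) p -> lpow g j p.
Proof.
move=> H; elim=> [|j IH] p //; rewrite mulnS.
move=> /lpow_ind; apply => // m Hm.
have [m1 [m2 [-> [H1 H2]]]] : exists m1 m2 : 'X_{1..c},
    m = (m1 + m2)%MM /\ mdeg m1 = s /\ mdeg m2 = (s * j)%N.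
  move: {H IH} (s * j)%N Hm => t; elim: s m => [|s IH] m Hm.
    by exists 0%MM, m; rewrite add0m mdeg0.
  have [i [m' [-> Hm']]] := mdegS_split Hm.
  have [m1 [m2 [-> [<- <-]]]] := IH _ Hm'.
  exists (m1 + U_(i))%MM, m2; rewrite mdegD mdeg1 addn1; split=> //.
  by rewrite -!addmA [(m2 + _)%MM]addmC.
rewrite mmap1D -add1n; apply: lpowM; first by apply: H; rewrite -H1; apply: lpow_mon.
by apply: IH; rewrite -H2; apply: lpow_mon.
Qed.

Lemma lpow_origin p : p.@[@origin _ _] = 0 -> lpow xv 1 p.
Proof.
rewrite meval_mpoly0 => p0; rewrite [p]mpolyE big_seq; apply: lideal_sum => // m.
rewrite mcoeff_msupp => pm; rewrite -mul_mpolyC; apply: lidealM => //.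
rewrite -(mmap1_id k m); apply: (@lpow_decr _ _ _ (mdeg m)); last exact: lpow_mon.
rewrite lt0n mdeg_eq0; apply: contra pm => /eqP ->; exact/eqP.
Qed.

(** A finite geometric series: [t = 1 - h / h(o)] lies in the maximal ideal, so [t ^+ s] lies in
    [A], and [1 - t ^+ s] is a multiple of [1 - t], hence of [h]. *)
Lemma lideal_inverse A s h : lideal A -> (forall p, lpow xv s p -> A p) ->
  h.@[@origin _ _] != 0 -> exists h', A (1 - h' * h).
Proof.
move=> HA Hs h0; pose t := 1 - (h.@[@origin _ _])^-1 *: h.
have : A (t ^+ s).
  apply: Hs; have /(lpow_exp s) : lpow xv 1 t; last by rewrite mul1n.
  by apply: lpow_origin; rewrite mevalB meval1 mevalZ mulVf // subrr.
have := subrX1 t s; set w := \sum_(i < s) _ => E At.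
exists ((h.@[@origin _ _])^-1 *: w).
suff -> : 1 - (h.@[@origin _ _])^-1 *: w * h = t ^+ s by [].
rewrite -scalerAl scalerAr mulrC.
have -> : (h.@[@origin _ _])^-1 *: h = - (t - 1) by rewrite /t; ring.
by rewrite mulNr -E opprK addrC subrK.
Qed.

Lemma lideal_scale A s h p : lideal A -> (forall p, lpow xv s p -> A p) ->
  h.@[@origin _ _] != 0 -> exists h', A (p - h' * (h * p)).
Proof.
move=> HA Hs h0; have [h' H] := lideal_inverse HA Hs h0; exists h'.
have -> : p - h' * (h * p) = p * (1 - h' * h) by ring.
exact: lidealM.
Qed.

(** Modulo [A] the monomials of degree [s] satisfy a square linear system whose matrix is, at the
    origin, diagonal with nonzero entries. Its determinant is a unit of [R], and the adjugate puts
    the product of each monomial with it in [A]. *)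
Lemma nakayama A s : lideal A ->
  (forall p, lpow xv s p -> exists2 a, A a & lpow xv s.+1 (p - a)) ->
  forall p, lpow xv s p -> A p.
Proof.
move=> HA H; pose T := 'X_{1..N < s.+1}.
pose g (b : T) : S := if mdeg b == s then 'X_[b] else 0.
have gen m : mdeg m = s -> exists b : T, g b = 'X_[m].
  move=> Hm; have lt : (mdeg m < s.+1)%N by rewrite Hm.
  by exists (BMultinom lt); rewrite /g /= Hm eqxx.
(* [B] is the ideal of combinations of the [g b] with coefficients in the maximal ideal; it contains
   [m^(s+1)]. *)
pose B p := exists2 h, h.@[@origin _ _] != 0 & exists2 c : T -> S,
   forall b, (c b).@[@origin _ _] = 0 & vanish X (h * p - \sum_b c b * g b).
have HB : lideal B.
  split.
  - move=> p Hp; exists 1; first by rewrite meval1 oner_neq0.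
    exists (fun _ => 0) => [b|]; first exact: meval0.
    by rewrite mul1r big1 ?subr0 // => i _; exact: mul0r.
  - move=> p p' [h h0 [q Bq Hq]] [h' h0' [q' Bq' Hq']].
    exists (h * h'); first by rewrite mevalM mulf_neq0.
    exists (fun i => h' * q i + h * q' i) => [i|].
      by rewrite mevalD !mevalM Bq Bq' !mulr0 addr0.
    have -> : h * h' * (p + p') - \sum_i (h' * q i + h * q' i) * g i =
      h' * (h * p - \sum_i q i * g i) + h * (h' * p' - \sum_i q' i * g i).
      under eq_bigr do rewrite mulrDl -!mulrA.
      by rewrite big_split /= !mulrBr -!mulr_sumr !mulrDr; ring.
    by apply: vanishD; apply: vanishM.
  - move=> a p [h h0 [q Bq Hq]]; exists h => //.
    exists (fun i => a * q i) => [i|]; first by rewrite mevalM Bq mulr0.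
    have -> : h * (a * p) - \sum_i a * q i * g i = a * (h * p - \sum_i q i * g i).
      by under eq_bigr do rewrite -!mulrA; rewrite -mulr_sumr; ring.
    exact: vanishM.
  - move=> a p a0 [h h0 [q Bq Hq]]; exists (h * a); first by rewrite mevalM mulf_neq0.
    by exists q => //; rewrite -mulrA.
have sB p : lpow xv s.+1 p -> B p.
  apply: lpow_ind => // m Hm; have [i [m' [-> Hm']]] := mdegS_split Hm.
  have [b Hb] := gen _ Hm'.
  exists 1; first by rewrite meval1 oner_neq0.
  exists (fun b' => if b' == b then 'X_i else 0) => [b'|].
    by case: ifP => _; rewrite ?meval0 ?mevalXU.
  rewrite (bigD1 b) //= eqxx big1 => [|b' /negbTE ->]; last exact: mul0r.
  rewrite Hb addr0 mmap1D mmap1U mmap1_id mul1r mulrC subrr; exact: vanish0.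
have Hb b : exists hc : S * (T -> S), [/\ hc.1.@[@origin _ _] != 0,
    forall b', (hc.2 b').@[@origin _ _] = 0 & A (hc.1 * g b - \sum_b' hc.2 b' * g b')].
  rewrite /g; case: eqP => [Hs|_]; last first.
    exists (1, fun _ => 0) => /=; split=> [|b'|]; [by rewrite meval1 oner_neq0|by rewrite meval0|].
    rewrite mulr0 big1 => [|b' _]; last exact: mul0r.
    by rewrite subr0; apply: (lidealV HA vanish0).
  have [|a Aa /sB[h h0 [c Hc V]]] := H 'X_[b].
    by rewrite -(mmap1_id k b) -{1}Hs; apply: lpow_mon.
  exists (h, c); split=> //=.
  apply: (lideal_iff HA (q := h * a)); last exact: lidealM.
  by apply: lidealV => //; move: V; rewrite mulrBr addrAC.
pose F b := epsilon (inhabits (0, fun _ => 0)) (fun hc : S * (T -> S) =>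
   [/\ hc.1.@[@origin _ _] != 0, forall b', (hc.2 b').@[@origin _ _] = 0
     & A (hc.1 * g b - \sum_b' hc.2 b' * g b')]).
have HF b := epsilon_spec (inhabits (0, fun _ => 0)) _ (Hb b).
rewrite -/(F _) in HF.
pose D := \matrix_(i < #|{: T}|, j < #|{: T}|)
   ((if i == j then (F (enum_val i)).1 else 0) - (F (enum_val i)).2 (enum_val j)).
have D0 : (\det D).@[@origin _ _] != 0.
  rewrite -det_map_mx.
  have -> : map_mx (meval (@origin _ _)) D = diag_mx (\row_i ((F (enum_val i)).1).@[@origin _ _]).
    apply/matrixP => i j; rewrite !mxE mevalB; case: (HF (enum_val i)) => _ -> _.
    by rewrite subr0; case: eqP => [->|_]; rewrite ?mulr1n ?meval0 ?mulr0n.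
  rewrite det_diag; apply/prodf_neq0 => i _; rewrite mxE.
  by case: (HF (enum_val i)).
apply: lpow_ind => // m /gen[b]; rewrite mmap1_id => <-.
apply: (lideal_unit HA D0).
pose v := \col_(i < #|{: T}|) g (enum_val i).
have Av i : A ((D *m v) i 0).
  have [_ _ Ai] := HF (enum_val i).
  suff -> : (D *m v) i 0 = (F (enum_val i)).1 * g (enum_val i)
       - \sum_b' (F (enum_val i)).2 b' * g b' by [].
  rewrite mxE (reindex (@enum_val T predT)) /=; last exact: (onW_bij _ (enum_val_bij T)).
  under eq_bigr do rewrite !mxE mulrBl.
  rewrite sumrB; congr (_ - _).
  rewrite (bigD1 i) //= eqxx big1 ?addr0 // => j; rewrite eq_sym => /negbTE ->.
  exact: mul0r.
have -> : \det D * g b = (\adj D *m (D *m v)) (enum_rank b) 0.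
  by rewrite mulmxA mul_adj_mx mul_scalar_mx !mxE enum_rankK.
by rewrite mxE; apply: lideal_sum => // i _; apply: lidealM.
Qed.

End LocalIdeals.
#[export] Hint Resolve lpow_lideal : core.

(** * The rank of the associated graded module *)

Section InSpan.
Context (k : fieldType) (E : lmodType k).
Implicit Types A : E -> Prop.

Definition inspan A (J : finType) (e : J -> E) p :=
  exists c : J -> k, A (p - \sum_j c j *: e j).

Lemma inspan_subspace A (J : finType) (e : J -> E) :
  subspace A -> subspace (inspan A e).
Proof.
move=> HA; case: (HA) => A0 AD AZ; split.
- exists (fun _ => 0); rewrite big1 ?subr0 // => j _; exact: scale0r.
- move=> u v [c Hc] [c' Hc']; exists (fun j => c j + c' j).
  under eq_bigr do rewrite scalerDl.
  by rewrite big_split /= opprD addrACA; apply: AD.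
- move=> a u [c Hc]; exists (fun j => a * c j).
  under eq_bigr do rewrite -scalerA.
  by rewrite -scaler_sumr -scalerBr; apply: AZ.
Qed.

Lemma inspan_sub A (J : finType) (e : J -> E) p : A p -> inspan A e p.
Proof.
by move=> Ap; exists (fun _ => 0); rewrite big1 ?subr0 // => j _; exact: scale0r.
Qed.

Lemma inspan_gen A (J : finType) (e : J -> E) j : A 0 -> inspan A e (e j).
Proof.
move=> A0; exists (fun j' => (j' == j)%:R).
rewrite (bigD1 j) //= eqxx scale1r big1 ?addr0 ?subrr // => i /negbTE ->.
exact: scale0r.
Qed.

End InSpan.

Section Filtration.
Context (k : closedFieldType) (N : nat) (X : aset k N) (n : nat).
Local Notation S := {mpoly k[N]}.
Local Notation D := {mpoly k[n]}.
Local Notation xv := (fun i : 'I_N => 'X_i : S).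
Local Notation ev f := (mmap (@mpolyC N k) f).
Implicit Types (A B : S -> Prop).

Lemma spans_monomials A s : lideal X A -> (forall p, lpow X xv s p -> A p) ->
  spans A (fun m : 'X_{1..N < s} => 'X_[m]).
Proof.
move=> HA Hs p; change (inspan A (fun m : 'X_{1..N < s} => 'X_[m]) p).
have HW := inspan_subspace (fun m : 'X_{1..N < s} => 'X_[m]) (lideal_subspace HA).
rewrite [p]mpolyE; apply: subspace_sum => // m _; case: (HW) => W0 _; apply.
have [lt|ge] := ltnP (mdeg m) s.
  apply: (inspan_gen (fun m : 'X_{1..N < s} => 'X_[m] : S) (BMultinom lt)).
  by case: (lideal_subspace HA).
apply/inspan_sub/Hs/(lpow_decr ge); rewrite -(mmap1_id k m).
exact: (lpow_mon X xv m).
Qed.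

Lemma exists_basis A s : lideal X A -> (forall p, lpow X xv s p -> A p) ->
  exists d (b : 'I_d -> S), spans A b /\ indep A b.
Proof.
move=> HA Hs; have [d [b [_ sb ib]]] :=
  spans_basis (lideal_subspace HA) (spans_monomials HA Hs).
by exists d, b.
Qed.

Definition box K := {ffun 'I_n -> 'I_K}.
Definition mon K (a : box K) : 'X_{1..n} := [multinom nat_of_ord (a i) | i < n].
Definition ncorner K := #|[pred a : box K | (mdeg (mon a) < K)%N]|.

Lemma mon_inj K : injective (@mon K).
Proof.
move=> a b /mnmP H; apply/ffunP => i; apply: val_inj => /=.
by have := H i; rewrite !mnmE.
Qed.

Lemma monP K (m : 'X_{1..n}) : (forall i, (m i < K)%N) -> exists a : box K, m = mon a.
Proof.
move=> H; exists [ffun i => Ordinal (H i)]; apply/mnmP => i.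
by rewrite mnmE ffunE.
Qed.

(** A monomial of the box is not above [m] only if some exponent [i] is below [m i], which leaves
    [m i] choices for it and [K] for each other exponent. The factor [K] on the left replaces an
    exponent [n - 1] on the right. *)
Lemma card_not_ge K (m : 'X_{1..n}) :
  (K * #|[pred a : box K | ~~ (m <= mon a)%MM]| <= mdeg m * K ^ n)%N.
Proof.
pose F (i : 'I_n) (l : 'I_n) : pred 'I_K := [pred v : 'I_K | (l == i) ==> (v < m i)%N].
have cF i : (K * #|family (F i)| <= m i * K ^ n)%N.
  rewrite card_family foldrE big_map big_enum /= (bigD1 i) //=.
  have -> : (K ^ n = K * K ^ n.-1)%N by rewrite -expnS prednK // (leq_ltn_trans _ (ltn_ord i)).
  rewrite [X in (_ <= X)%N]mulnCA leq_mul2l; apply/orP; right.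
  apply: leq_mul.
    apply: (@leq_trans #|[pred v : 'I_K | (v < m i)%N]|).
      by apply: subset_leq_card; apply/subsetP => v; rewrite !inE eqxx.
    rewrite cardE -(size_map val) -[X in (_ <= X)%N](size_iota 0).
    apply: uniq_leq_size; first by rewrite map_inj_uniq ?enum_uniq //; exact: val_inj.
    by move=> _ /mapP[v + ->]; rewrite mem_enum mem_iota /= inE.
  rewrite (eq_bigr (fun _ => K)) => [|l /negbTE li]; last first.
    by rewrite -[RHS]card_ord; apply: eq_card => v; rewrite !inE li.
  rewrite prod_nat_const leq_eqVlt; apply/orP; left; apply/eqP; congr (_ ^ _)%N.
  by rewrite (eq_card (B := predC1 i)) // cardC1 card_ord.
have sub : (#|[pred a : box K | ~~ (m <= mon a)%MM]| <= \sum_i #|family (F i)|)%N.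
  rewrite -sum1_card.
  apply: (@leq_trans (\sum_(a : box K) \sum_i (a \in family (F i)))).
    rewrite big_mkcond; apply: leq_sum => a _; rewrite inE; case: ifP => // Ha.
    have /existsP[i Hi] : [exists i, ~~ (m i <= mon a i)%N].
      by rewrite -negb_forall; apply: contra Ha => /forallP H; apply/mnm_lepP.
    rewrite (bigD1 i) //= (_ : a \in _) //; apply/familyP => l; rewrite inE.
    by apply/implyP => /eqP ->; move: Hi; rewrite mnmE -ltnNge.
  rewrite exchange_big; apply: leq_sum => i _.
  by rewrite -sum1_card [X in (_ <= X)%N]big_mkcond; apply: leq_sum => a _; case: (_ \in _).
apply: (leq_trans (leq_mul (leqnn K) sub)).
by rewrite big_distrr /= mdegE big_distrl /=; apply: leq_sum => i _.
Qed.

Section Rank.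
Context (f : 'I_n -> S) (s d : nat) (b : 'I_d -> S).
Hypothesis Hs : forall p, lpow X xv s p -> lpow X f 1 p.
Hypothesis Hb : spans (lpow X f 1) b.
Implicit Types v : 'I_d -> D.

Lemma lpow_ev j (t : D) : t \is j.-homog -> lpow X f j (ev f t).
Proof.
move=> /dhomogP H; rewrite /mmap big_seq.
apply: (lideal_sum (lpow_lideal X f j)) => m /H <-.
by apply: lidealM => //; apply: lpow_mon.
Qed.

Lemma lpow_expand j p : lpow X f j p ->
  exists2 v, forall i, v i \is j.-homog & lpow X f j.+1 (p - \sum_i b i * ev f (v i)).
Proof.
elim: j p => [|j IH] p.
  move=> _; have [c Hc] := Hb p; exists (fun i => (c i)%:MP).
    by move=> i; rewrite -[_%:MP]mulr1 mul_mpolyC; apply/dhomogZ/dhomog1.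
  suff -> : \sum_i b i * ev f (c i)%:MP = \sum_i c i *: b i by [].
  by apply: eq_bigr => i _; rewrite mmapC mulrC mul_mpolyC.
move=> Hp; case: (Hp) => h h0 [q Hq Hv].
(* The denominator [h] is inverted only modulo the ideal of [f]; as [p] lies in the power [j + 1],
   the error [(1 - h' * h) * p] lies in the power [j + 2]. *)
have [h' Hh'] := lideal_inverse (lpow_lideal X f 1) Hs h0.
have E i : exists v : 'I_d -> D, (forall l, v l \is j.-homog) /\
    lpow X f j.+1 (h' * q i - \sum_l b l * ev f (v l)).
  have [|v Hv1 Hv2] := IH (h' * q i); last by exists v.
  by apply: lidealM => //; apply: Hq.
pose V i := epsilon (inhabits (fun _ => 0)) (fun v : 'I_d -> D => (forall l, v l \is j.-homog) /\
    lpow X f j.+1 (h' * q i - \sum_l b l * ev f (v l))).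
have HV i := epsilon_spec (inhabits (fun _ => 0)) _ (E i).
rewrite -/(V _) in HV.
exists (fun l => \sum_i V i l * 'X_i).
  move=> l; apply: rpred_sum => i _; rewrite -addn1; apply: dhomogM; first by case: (HV i) => H _; apply: H.
  by rewrite dhomogX /= mdeg1.
have L2 := lpow_lideal X f j.+2.
apply: (lideal_iff L2 (q := h' * (h * p) - \sum_l b l * ev f (\sum_i V i l * 'X_i))).
  rewrite opprB addrA subrK.
  have -> : p - h' * (h * p) = (1 - h' * h) * p by ring.
  by rewrite -(addn1 j.+1) addnC; apply: lpowM.
apply: (lideal_iff L2 (q := \sum_i h' * q i * f i - \sum_l b l * ev f (\sum_i V i l * 'X_i))).
  rewrite opprB addrA subrK.
  under eq_bigr do rewrite -mulrA.
  by rewrite -mulr_sumr -mulrBr; apply: lidealM => //; apply: (lidealV L2).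
have -> : \sum_l b l * ev f (\sum_i V i l * 'X_i)
    = \sum_i (\sum_l b l * ev f (V i l)) * f i.
  under eq_bigr do rewrite raddf_sum mulr_sumr /=.
  rewrite exchange_big; apply: eq_bigr => i _; rewrite mulr_suml; apply: eq_bigr => l _.
  by rewrite rmorphM /= mmapX mmap1U mulrA.
rewrite -sumrB; apply: lideal_sum => // i _; rewrite -mulrBl.
by apply: lpowS; case: (HV i).
Qed.

(* A relation of degree [j] between the classes of the [b_i] in the associated graded
   module, with coefficients in [k[T_1, ..., T_n]]. *)
Definition rel j v :=
  (forall i, v i \is j.-homog) /\ lpow X f j.+1 (\sum_i b i * ev f (v i)).

Lemma rel_mul l j (t : D) v : t \is l.-homog -> rel j v -> rel (l + j) (fun i => t * v i).
Proof.
move=> Ht [H1 H2]; split=> [i|]; first exact: dhomogM.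
have -> : \sum_i b i * ev f (t * v i) = ev f t * \sum_i b i * ev f (v i).
  by rewrite mulr_sumr; apply: eq_bigr => i _; rewrite rmorphM /= mulrCA.
by rewrite -addnS; apply: lpowM => //; apply: lpow_ev.
Qed.

(* Independence over [k[T_1, ..., T_n]] of the [b_i] with [i] in [P]. *)
Definition free (P : {set 'I_d}) :=
  forall j v, rel j v -> (forall i, i \notin P -> v i = 0) -> forall i, v i = 0.

(** Coefficients vanish degree by degree: once those of degree below [t] are zero, the part of
    degree [t] lies in the power [t + 1], because the terms of higher degree do and [t < K].
    Freeness applies to this homogeneous relation. *)
Lemma free_indep P K : free P ->
  indep (lpow X f K) (fun x : {x : 'I_d * box K | (x.1 \in P) && (mdeg (mon x.2) < K)%N} =>
    b (val x).1 * mmap1 f (mon (val x).2)).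
Proof.
move=> HP c Hc.
pose dg (x : {x : 'I_d * box K | (x.1 \in P) && (mdeg (mon x.2) < K)%N}) :=
  mdeg (mon (val x).2).
suff H t : forall x, dg x = t -> c x = 0 by move=> x; apply: (H (dg x)).
elim/ltn_ind: t => t IH x0 Hx0.
pose v i : D := \sum_(x | (dg x == t) && ((val x).1 == i)) c x *: 'X_[mon (val x).2].
have [Hrel Hsupp] : rel t v /\ forall i, i \notin P -> v i = 0.
  split; last first.
    move=> i iP; rewrite /v big_pred0 // => x; apply/negbTE; apply: contra iP.
    by case/andP => _ /eqP <-; case/andP: (valP x).
  split.
    move=> i; apply: rpred_sum => x /andP[/eqP Hx _]; apply: dhomogZ.
    by rewrite dhomogX; apply/eqP.
  have -> : \sum_i b i * ev f (v i) =
     \sum_(x | dg x == t) c x *: (b (val x).1 * mmap1 f (mon (val x).2)).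
    rewrite [RHS](partition_big (fun x => (val x).1) predT) //=.
    apply: eq_bigr => i _; rewrite raddf_sum mulr_sumr /=; apply: eq_bigr => x /andP[_ /eqP <-].
    by rewrite mmapZ mmapX -mul_mpolyC mulrCA.
  have L := lpow_lideal X f t.+1.
  move: Hc; rewrite (bigID (fun x => dg x == t)) /= => Hc.
  rewrite -(addrK (\sum_(x | dg x != t) c x *: (b (val x).1 * mmap1 f (mon (val x).2)))
    (\sum_(x | dg x == t) _)).
  apply: (lidealB L).
    apply: (@lpow_decr _ _ _ _ _ t.+1 K); last exact: Hc.
    rewrite -Hx0 /dg; by case/andP: (valP x0).
  apply: (lideal_sum L) => x ne; have [lt|ge] := ltnP (dg x) t.
    by rewrite (IH _ lt) // scale0r; apply: (lidealV L); apply: vanish0.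
  rewrite -mul_mpolyC; do 2!apply: (lidealM _ L).
  apply: (@lpow_decr _ _ _ _ _ _ (dg x)); last exact: lpow_mon.
  by rewrite ltn_neqAle eq_sym ne.
have /(congr1 (mcoeff (mon (val x0).2))) := HP _ _ Hrel Hsupp (val x0).1.
rewrite mcoeff0 raddf_sum /= (bigD1 x0) /=; last by rewrite Hx0 !eqxx.
rewrite mcoeffZ mcoeffX eqxx mulr1 big1 ?addr0 // => x /andP[/andP[_ /eqP H1] ne].
rewrite mcoeffZ mcoeffX; case: eqP => [/mon_inj H2|]; last by rewrite mulr0.
case/eqP: ne; apply: val_inj.
by rewrite [val x]surjective_pairing [val x0]surjective_pairing H1 H2.
Qed.

(** A relation witnessing that [i |: P] is not free must involve [b_i]; otherwise it would be a
    nonzero relation on [P]. *)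
Lemma exists_max_free : exists2 P, free P & forall i, i \notin P ->
  exists j v, [/\ rel j v, forall l, l \notin P -> l != i -> v l = 0 & v i != 0].
Proof.
have [P] : exists P, free P by exists set0 => j v _ H i; apply: H; rewrite inE.
move: {2}#|~: P| (leqnn #|~: P|) => t; elim: t P => [|t IH] P le HP.
  exists P => // i iP; move: le; rewrite leqn0 cards_eq0 => /eqP E.
  by move: (in_set0 i); rewrite -E inE iP.
have [[i iP HiP]|H] := classic (exists2 i, i \notin P & free (i |: P)).
  apply: (IH _ _ HiP); rewrite -ltnS; apply: leq_trans le.
  apply: proper_card; apply/properP; split.
    by apply/subsetP => l; rewrite !inE negb_or => /andP[].
  by exists i; rewrite !inE ?eqxx.
exists P => // i iP; apply: NNPP => Hn; apply: H; exists i => // j v Hr Hs' l.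
have [vi|/eqP vi] := classic (v i = 0).
  apply: (HP j v Hr) => l' l'P; have [->//|ne] := eqVneq l' i.
  by apply: Hs'; rewrite !inE negb_or ne.
case: Hn; exists j, v; split=> // l' l'P ne.
by apply: Hs'; rewrite !inE negb_or ne.
Qed.

(** The predicate [bx] selects the exponents that survive modulo [B]; it is the corner of degree
    below [K] for the power [K], and the whole box for the ideal of the [f_i ^+ K]. The reduction is
    a double induction: downwards on the power of the ideal, starting from [J], and on the monomial
    order within one degree. *)
Lemma spans_corner (P : {set 'I_d}) (mu : 'I_d -> 'X_{1..n}) (B : S -> Prop) J K
    (bx : pred (box K)) :
  (forall i, i \notin P -> exists j v,
    [/\ rel j v, forall l, l \notin P -> l != i -> v l = 0, v i != 0 & mlead (v i) = mu i]) ->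
  lideal X B -> (forall p, lpow X f J p -> B p) ->
  (forall m, (exists2 a, bx a & m = mon a) \/ B (mmap1 f m)) ->
  spans B (fun x : {x : 'I_d * box K | bx x.2 && ((x.1 \in P) || ~~ (mu x.1 <= mon x.2)%MM)} =>
    b (val x).1 * mmap1 f (mon (val x).2)).
Proof.
move=> Hmu HB JB Hbx; pose e (x : {x : 'I_d * box K | bx x.2 && ((x.1 \in P) || ~~ (mu x.1 <= mon x.2)%MM)}) :=
  b (val x).1 * mmap1 f (mon (val x).2).
change (forall p, inspan B e p).
have HW := inspan_subspace e (lideal_subspace HB).
have gen i m : (i \in P) || ~~ (mu i <= m)%MM -> inspan B e (b i * mmap1 f m).
  move=> Him; case: (Hbx m) => [[a ba Em]|Bm]; last by apply: inspan_sub; apply: (lidealM _ HB).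
  have Hx : bx (i, a).2 && (((i, a).1 \in P) || ~~ (mu (i, a).1 <= mon (i, a).2)%MM).
    by rewrite /= ba -Em.
  rewrite Em; apply: (inspan_gen e (exist _ (i, a) Hx)).
  by case: (lideal_subspace HB).
have evW i (t : D) : (forall m, m \in msupp t -> inspan B e (b i * mmap1 f m)) ->
    inspan B e (b i * ev f t).
  move=> H; rewrite /mmap mulr_sumr big_seq; apply: (subspace_sum _ HW) => m /H Hm.
  by rewrite mulrCA mul_mpolyC; case: HW => _ _; apply.
suff H t : (t <= J)%N -> forall p, lpow X f (J - t) p -> inspan B e p.
  by move=> p; apply: (H J) => //; rewrite subnn.
elim: t => [|t IH] lt p.
  by rewrite subn0 => /JB; apply: inspan_sub.
have {IH} IH := IH (ltnW lt).
have E : (J - t)%N = (J - t.+1).+1 by rewrite subnSK.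
move: (J - t.+1)%N E IH => j -> {lt t} IH /lpow_expand[v Hv /IH].
move/(subspace_iff HW); apply; apply: (subspace_sum _ HW) => i _.
apply: (evW) => m Hm; have {Hm} : mdeg m = j by move/dhomogP: (Hv i) => /(_ _ Hm).
(* The relation of index [i], multiplied by [T^(m - mu i)], has an [i]-th coefficient with leading
   monomial [m]. Its other terms have index in [P] and its sum lies in the power [j + 1], so
   [b_i f^m] reduces to smaller monomials of the same degree. *)
elim/(@ltmwf n): m => m IHm Hj.
have [/gen//|] := boolP ((i \in P) || ~~ (mu i <= m)%MM).
rewrite negb_or negbK => /andP[iP le].
have [j' [w [Hr Hw wi Hmui]]] := Hmu i iP.
have dmu : mdeg (mu i) = j'.
  by case: Hr => /(_ i)/dhomogP/(_ (mu i)) + _; apply; rewrite -Hmui mlead_supp.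
pose t : D := 'X_[m - mu i].
have dt : mdeg (m - mu i)%MM = (j - j')%N.
  by rewrite -Hj -{2}(submK le) mdegD dmu addnK.
have le' : (j' <= j)%N by rewrite -Hj -(submK le) mdegD dmu leq_addl.
have Ht : t \is (j - j').-homog by rewrite dhomogX; apply/eqP.
have := rel_mul Ht Hr; rewrite subnK // => -[h1 /IH Hsum].
have tw : mlead (t * w i) = m.
  by rewrite mleadM ?mleadXm ?Hmui ?submK // -msupp_eq0 msuppX.
have tw0 : (t * w i)@_m != 0.
  by rewrite -[X in _@_X]tw -/(mleadc _) mleadc_eq0 mulf_neq0 // -msupp_eq0 msuppX.
have {Hsum} : inspan B e (b i * ev f (t * w i)).
  have -> : b i * ev f (t * w i) = \sum_l b l * ev f (t * w l)
     - \sum_(l | l != i) b l * ev f (t * w l).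
    by rewrite (bigD1 i) //= addrK.
  apply: (subspaceB HW) => //; apply: (subspace_sum _ HW) => l li.
  have [lP|lP] := boolP (l \in P); last first.
    by rewrite Hw // mulr0 mmap0 mulr0; case: HW.
  by apply: evW => m' _; apply: gen; rewrite lP.
rewrite /mmap (bigD1_seq m) ?msupp_uniq ?mcoeff_msupp //= mulrDr mulr_sumr => Hsum.
have : inspan B e (b i * (((t * w i)@_m)%:MP * mmap1 f m)).
  rewrite -[_ * _](addrK (\sum_(m' <- msupp (t * w i) | m' != m)
      b i * (((t * w i)@_m')%:MP * mmap1 f m'))).
  apply: (subspaceB HW) => //; rewrite big_seq_cond.
  apply: (subspace_sum _ HW) => m' /andP[Hm' ne].
  rewrite mulrCA mul_mpolyC; case: HW => _ _; apply; apply: IHm.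
    by rewrite Order.POrderTheory.lt_neqAle ne -tw msupp_le_mlead.
  by move/dhomogP: (h1 i) => /(_ _ Hm').
rewrite mulrCA mul_mpolyC => H; case: HW => _ _ /(_ ((t * w i)@_m)^-1 _ H).
by rewrite scalerA mulVf // scale1r.
Qed.

(* The relation of index [i] rewrites [b_i f^m], for [mu i <= m], in terms of smaller
   monomials, so only the [m] not above [mu i] count; there are at most
   [C K^(n-1)] of them in a box, a bound stated here multiplied by [K]. *)
Lemma hilbert_bounds : exists r C,
  (forall K, exists (J : finType) (e : J -> S),
    #|J| = (r * ncorner K)%N /\ indep (lpow X f K) e) /\
  (forall (B : S -> Prop) J K (bx : pred (box K)),
    lideal X B -> (forall p, lpow X f J p -> B p) ->
    (forall m, (exists2 a, bx a & m = mon a) \/ B (mmap1 f m)) ->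
    exists (I : finType) (e : I -> S), [/\ spans B e, (#|I| <= d * #|bx|)%N &
      (K * #|I| <= K * (r * #|bx|) + C * K ^ n)%N]).
Proof.
have [P HP Hmax] := exists_max_free.
have [mu Hmu] : exists mu : 'I_d -> 'X_{1..n}, forall i, i \notin P -> exists j v,
    [/\ rel j v, forall l, l \notin P -> l != i -> v l = 0, v i != 0 & mlead (v i) = mu i].
  pose Q i m := exists j v,
    [/\ rel j v, forall l, l \notin P -> l != i -> v l = 0, v i != 0 & mlead (v i) = m].
  exists (fun i => epsilon (inhabits 0%MM) (Q i)) => i iP.
  apply: (epsilon_spec (inhabits 0%MM) (Q i)); have [j [v [H1 H2 H3]]] := Hmax i iP.
  by exists (mlead (v i)), j, v.
exists #|P|, (\sum_i mdeg (mu i))%N; split=> [K|B J K bx HB JB Hbx].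
  exists {x : 'I_d * box K | (x.1 \in P) && (mdeg (mon x.2) < K)%N}.
  exists (fun x => b (val x).1 * mmap1 f (mon (val x).2)); split; last exact: free_indep.
  by rewrite card_sig -cardX; apply: eq_card => -[i a]; rewrite !inE.
exists {x : 'I_d * box K | bx x.2 && ((x.1 \in P) || ~~ (mu x.1 <= mon x.2)%MM)}.
exists (fun x => b (val x).1 * mmap1 f (mon (val x).2)); split.
- exact: spans_corner Hmu HB JB Hbx.
- rewrite card_sig -[X in (X * _)%N](card_ord d) -cardX.
  by apply: subset_leq_card; apply/subsetP => -[i a]; rewrite !inE /= => /andP[].
rewrite card_sig.
apply: (@leq_trans (K * (#|P| * #|bx| + \sum_i #|[pred a : box K | ~~ (mu i <= mon a)%MM]|))).
  rewrite leq_mul2l; apply/orP; right; rewrite -cardX.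
  have -> : (\sum_i #|[pred a : box K | ~~ (mu i <= mon a)%MM]|)%N
      = #|[pred x : 'I_d * box K | ~~ (mu x.1 <= mon x.2)%MM]|.
    rewrite -sum1_card; under eq_bigr do rewrite -sum1_card.
    by rewrite pair_big_dep; apply: eq_bigl => -[i a]; rewrite !inE.
  rewrite -cardUI; apply: (leq_trans _ (leq_addr _ _)).
  apply: subset_leq_card; apply/subsetP => -[i a]; rewrite !inE /=.
  by case/andP => ba; rewrite (_ : a \in bx) ?andbT.
rewrite mulnDr leq_add2l big_distrr big_distrl /=.
by apply: leq_sum => i _; apply: card_not_ge.
Qed.

End Rank.
End Filtration.

(** * Colengths of the powers of a system *)

Section CornerCount.
Local Open Scope nat_scope.

Lemma ncornerE n K : ncorner n K.+1 = 'C(n + K, n).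
Proof.
rewrite -card_partial_ord_partitions /ncorner -(card_image (can_inj (@tuple_of_finfunK 'I_K.+1 n))).
apply: eq_card => t; rewrite inE; apply/imageP/idP => [[a Ha ->]|Ht].
  move: Ha; rewrite inE ltnS mdegE big_tuple => H; apply: leq_trans H.
  by rewrite leq_eqVlt; apply/orP; left; apply/eqP; apply: eq_bigr => i _; rewrite mnmE tnth_mktuple.
exists (finfun_of_tuple t); last by rewrite finfun_of_tupleK.
rewrite inE ltnS mdegE; move: Ht; rewrite big_tuple => H; apply: leq_trans H.
by rewrite leq_eqVlt; apply/orP; left; apply/eqP; apply: eq_bigr => i _; rewrite mnmE ffunE.
Qed.

Lemma ncorner_ffact n K : n`! * ncorner n K.+1 = (n + K) ^_ n.
Proof. by rewrite ncornerE mulnC bin_ffact. Qed.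

Lemma ncorner_ge n K : 0 < K -> K ^ n <= n`! * ncorner n K.
Proof.
case: K => // K _; rewrite ncorner_ffact; elim: n => [|n IH] //.
by rewrite addSn ffactSS expnS leq_mul // ltnS leq_addl.
Qed.

(** The left count is the product of [K, ..., K + n - 1]. A further factor [K + n] turns the
    constant [c] into [n + c + n * c], where [1 <= K] absorbs the cross term. *)
Lemma ncorner_le n : exists c, forall K, 0 < K ->
  K * (n`! * ncorner n K) <= K * K ^ n + c * K ^ n.
Proof.
elim: n => [|n [c IH]].
  by exists 0 => -[//|K] _; rewrite ncorner_ffact ffactn0 expn0 addn0.
exists (n + c + n * c) => -[//|K] _; have := IH K.+1 isT.
rewrite !ncorner_ffact addSn ffactSS => H.
rewrite mulnCA; apply: (leq_trans (leq_mul (leqnn _) H)).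
rewrite !expnS -addnS; move: (K.+1 ^ n) => x; nia.
Qed.

End CornerCount.

Section SystemMultiplicity.
Context (k : closedFieldType) (N : nat) (X : aset k N) (n : nat).
Local Notation S := {mpoly k[N]}.
Local Notation xv := (fun i : 'I_N => 'X_i : S).
Implicit Types (A B : S -> Prop) (p : S) (f : 'I_n -> S).

Definition codim A d := exists e : 'I_d -> S, spans A e /\ indep A e.

Lemma codim_le_spans A d (J : finType) (e : J -> S) :
  lideal X A -> codim A d -> spans A e -> (d <= #|J|)%N.
Proof.
move=> HA [b [_ ib]] se.
by rewrite -{1}(card_ord d); exact: (indep_le_spans (lideal_subspace HA) se ib).
Qed.

Lemma indep_le_codim A d (J : finType) (e : J -> S) :
  lideal X A -> codim A d -> indep A e -> (#|J| <= d)%N.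
Proof.
move=> HA [b [sb _]] ie.
by rewrite -{1}(card_ord d); exact: (indep_le_spans (lideal_subspace HA) sb ie).
Qed.

Definition isol (f : 'I_n -> S) := exists s, forall p, lpow X xv s p -> lpow X f 1 p.

Lemma isol_pow f j : isol f -> exists s, forall p, lpow X xv s p -> lpow X f j p.
Proof. by case=> s Hs; exists (s * j)%N; apply: lpow_comp. Qed.

Lemma codim_exists f j : isol f -> exists d, codim (lpow X f j) d.
Proof.
case/(isol_pow j) => s Hs.
by have [d [b H]] := exists_basis (lpow_lideal X f j) Hs; exists d, b.
Qed.

Lemma lpow_frob_mon f K (m : 'X_{1..n}) (i : 'I_n) : (K <= m i)%N ->
  lpow X (fun i => f i ^+ K) 1 (mmap1 f m).
Proof.
move=> Hi; rewrite /mmap1 (bigD1 i) //= -(subnK Hi) exprD mulrAC.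
apply: (lidealM _ (lpow_lideal X (fun i => f i ^+ K) 1)).
exact: (lpow1 X (fun i => f i ^+ K) i).
Qed.

(** By the pigeonhole principle, a monomial of degree above [n * K] in [n] variables has an exponent
    at least [K]. *)
Lemma lpow_frob f K J p : (n * K < J)%N -> lpow X f J p -> lpow X (fun i => f i ^+ K) 1 p.
Proof.
move=> lt; apply: lpow_ind => // m Hm.
have [i Hi] : exists i, (K <= m i)%N.
  apply/existsP; apply: contraLR lt; rewrite negb_exists => /forallP H.
  rewrite -leqNgt -Hm mdegE -[X in (X * _)%N]card_ord -sum_nat_const.
  by apply: leq_sum => i _; apply: ltnW; rewrite ltnNge.
exact: lpow_frob_mon Hi.
Qed.

Lemma isol_frob f K : isol f -> isol (fun i => f i ^+ K).
Proof.
case/(isol_pow (n * K).+1) => s Hs; exists s => p /Hs.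
exact: lpow_frob.
Qed.

Lemma lpow_of_frob f K j p : lpow X (fun i => f i ^+ K) j p -> lpow X f (K * j) p.
Proof.
elim: j p => [|j IH] p; first by rewrite muln0.
apply: lpow_step => // i q /IH Hq; rewrite mulnSr; apply: lpowM => //.
by have := lpow_exp K (lpow1 X f i); rewrite mul1n.
Qed.

Lemma multiplicity_bounds f : isol f -> exists r C, forall K, (0 < K)%N ->
  (forall l, codim (lpow X f K) l ->
     (r * K ^ n <= n`! * l)%N /\ (K * (n`! * l) <= K * (r * K ^ n) + C * K ^ n)%N) /\
  (forall l, codim (lpow X (fun i => f i ^+ K) 1) l ->
     (r * K ^ n <= l)%N /\ (K * l <= K * (r * K ^ n) + C * K ^ n)%N).
Proof.
move=> Hf; case: (Hf) => s Hs.
have [d [b [Hb _]]] := exists_basis (lpow_lideal X f 1) Hs.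
have [r [C [low up]]] := hilbert_bounds Hs Hb.
have [c Hc] := ncorner_le n.
(* The first [C] is the error for the [f_i ^+ K]; the other two terms are the error for the powers
   of the ideal, [r * c] coming from the monomial count. One constant serves both. *)
exists r, (C + n`! * C + r * c)%N => K K0; split=> l Hl; split.
- have [J [e [cJ ie]]] := low K.
  have := indep_le_codim (lpow_lideal X f K) Hl ie; rewrite cJ => H.
  apply: (leq_trans (leq_mul (leqnn r) (ncorner_ge n K0))).
  by rewrite mulnCA leq_mul2l H orbT.
- have [|m|J [e [se _ cJ]]] := up _ K K [pred a : box n K | (mdeg (mon a) < K)%N] (lpow_lideal X f K).
  + by [].
  + have [lt|ge] := ltnP (mdeg m) K.
      left; have [|a Ea] := @monP n K m; last by exists a => //=; rewrite -Ea.
      by move=> i; apply: leq_ltn_trans lt; rewrite mdegE (bigD1 i) //= leq_addr.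
    by right; apply: (lpow_decr ge); apply: lpow_mon.
  have := codim_le_spans (lpow_lideal X f K) Hl se.
  rewrite -/(ncorner n K) in cJ * => H; have {H cJ} H := leq_trans (leq_mul (leqnn K) H) cJ.
  have H1 := leq_mul (leqnn n`!) H; have H2 := leq_mul (leqnn r) (Hc K K0).
  move: (ncorner n K) (K ^ n)%N n`! H1 H2 => a q t; nia.
- pose f' i := f i ^+ K.
  have [b' [Hb' _]] := Hl; have [s' Hs'] := isol_frob K Hf.
  have [r' [C' [_ up']]] := hilbert_bounds Hs' Hb'.
  (* The [j]-th power of [(f_i^K)] lies in the [K j]-th power of [(f_i)];
     comparing the lengths for [j] large gives the bound. *)
  have main j : (0 < j)%N -> (r * ncorner n (K * j) <= l * ncorner n j)%N.
    move=> j0.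
    have [|m|J [e [se cJ _]]] := up' _ j j [pred a : box n j | (mdeg (mon a) < j)%N] (lpow_lideal X f' j).
    + by [].
    + have [lt|ge] := ltnP (mdeg m) j.
        left; have [|a Ea] := @monP n j m; last by exists a => //=; rewrite -Ea.
        by move=> i; apply: leq_ltn_trans lt; rewrite mdegE (bigD1 i) //= leq_addr.
      by right; apply: (lpow_decr ge); apply: lpow_mon.
    have [J' [e' [<- ie']]] := low (K * j)%N.
    apply: leq_trans cJ; apply: (indep_le_spans (lideal_subspace (lpow_lideal X f (K * j)))) ie'.
    by apply: spans_sub se => p; apply: lpow_of_frob.
  rewrite leqNgt; apply/negP => Hlt.
  (* If [l < r * K ^ n], then [main] at [j] yields, after cancelling [j ^ n],
     [j * l.+1 <= l * j + l * c], that is [j <= l * c]; this is the first [j] that contradicts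
     it. *)
  pose j := (l * c).+1; have j0 : (0 < j)%N by [].
  have H1 := leq_mul (leqnn n`!) (main j j0).
  have H2 := leq_mul (leqnn r) (ncorner_ge n (K := K * j) _).
  rewrite muln_gt0 K0 j0 expnMn in H2; have {}H2 := H2 isT.
  have H3 := leq_mul (leqnn l) (Hc j j0).
  have jn : (0 < j ^ n)%N by rewrite expn_gt0.
  have H4 : (j * (r * K ^ n) * j ^ n <= (l * j + l * c) * j ^ n)%N.
    have {}H1 := leq_mul (leqnn j) H1; have {}H2 := leq_mul (leqnn j) H2.
    move: H1 H2 H3; move: (ncorner n (K * j)) (ncorner n j) => a a1.
    by move: (K ^ n)%N (j ^ n)%N n`! (j : nat) => x y z t; nia.
  rewrite leq_mul2r in H4; case/orP: H4 => [/eqP E|H4]; first by rewrite E in jn.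
  have : (j * l.+1 <= l * j + l * c)%N by apply: leq_trans H4; rewrite leq_mul2l Hlt orbT.
  by rewrite mulnS mulnC addnC leq_add2l /j ltnn.
- have [|m|J [e [se _ cJ]]] := up _ (n * K).+1 K predT (lpow_lideal X (fun i => f i ^+ K) 1).
  + by move=> p; apply: lpow_frob.
  + have [[i Hi]|H] := classic (exists i, (K <= m i)%N).
      by right; apply: lpow_frob_mon Hi.
    left; have [|a Ea] := @monP n K m; last by exists a.
    by move=> i; rewrite ltnNge; apply/negP => Hi; apply: H; exists i.
  have := codim_le_spans (lpow_lideal X (fun i => f i ^+ K) 1) Hl se => H.
  have := leq_trans (leq_mul (leqnn K) H) cJ.
  rewrite (eq_card (B := predT)) // card_ffun !card_ord => H1; apply: (leq_trans H1).
  by rewrite leq_add2l leq_mul2r -addnA leq_addr orbT.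
Qed.

End SystemMultiplicity.

(** * The multiplicity of a system *)

Section RealLimit.
Local Close Scope ring_scope.
Local Open Scope R_scope.

(** Division squeezes [a K / K^n] between [r] and [r + C / K]. *)
Lemma Un_cv_of_bounds (a : nat -> nat) (n r C : nat) :
  (forall K, leq 1 K -> leq (muln r (expn K n)) (a K) /\
     leq (muln K (a K)) (addn (muln K (muln r (expn K n))) (muln C (expn K n)))) ->
  Rseries.Un_cv (fun j => INR (a j) / Rpow_def.pow (INR j) n) (INR r).
Proof.
move=> H eps eps0.
have [M HM] := RIneq.INR_archimed eps (INR C) eps0.
have C0 := RIneq.pos_INR C.
have M0 : (0 < M)%coq_nat.
  by apply/ltP; rewrite lt0n; apply/eqP => E; rewrite E /= in HM; Lra.lra.
exists M => j jM; rewrite /Rfunctions.Rdist.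
have j0 : (0 < j)%coq_nat by lia.
have [/leP/RIneq.le_INR lo /leP/RIneq.le_INR hi] := H j ltac:(by apply/ltP).
have pw : INR (expn j n) = Rpow_def.pow (INR j) n.
  elim: (n) => [|t IH]; first by rewrite expn0.
  by rewrite expnS RIneq.mult_INR IH.
rewrite RIneq.mult_INR pw in lo.
rewrite RIneq.plus_INR !RIneq.mult_INR pw in hi.
have j1 := RIneq.lt_0_INR j j0.
have p0 := Rfunctions.pow_lt (INR j) n j1.
have Mj : INR M <= INR j by apply: RIneq.le_INR.
set x := INR (a j) in lo hi *; set p := Rpow_def.pow (INR j) n in lo hi p0 *.
have lo' : INR r <= x / p.
  apply: (RIneq.Rmult_le_reg_r p) => //.
  by rewrite /Rdiv Raxioms.Rmult_assoc Raxioms.Rinv_l; Lra.lra.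
have hi' : x / p < INR r + eps.
  apply: (RIneq.Rmult_lt_reg_r (INR j * p)); first exact: RIneq.Rmult_lt_0_compat.
  have -> : x / p * (INR j * p) = INR j * x.
    have E : / p * p = 1 by apply: Raxioms.Rinv_l; Lra.lra.
    have -> : x / p * (INR j * p) = INR j * x * (/ p * p) by rewrite /Rdiv; Lra.lra.
    by rewrite E; Lra.lra.
  apply: (RIneq.Rle_lt_trans _ _ _ hi).
  have : INR C * p < INR j * eps * p.
    apply: RIneq.Rmult_lt_compat_r => //; apply: (RIneq.Rlt_le_trans _ _ _ HM).
    by apply: RIneq.Rmult_le_compat_r => //; Lra.lra.
  Lra.lra.
rewrite Rbasic_fun.Rabs_right; Lra.lra.
Qed.

End RealLimit.

(** * Fractions of the local ring and their numerators *)

Section Germs.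
Context (k : closedFieldType) (N : nat) (X : aset k N) (X0 : X (@origin k N)).
Local Notation S := {mpoly k[N]}.
Local Notation xv := (fun i : 'I_N => 'X_i : S).
Implicit Types (A : S -> Prop) (J : germ k N -> Prop) (p q h : S) (u v : germ k N).

Lemma isR_fpoly p : isR (fpoly p).
Proof. by rewrite /isR /= meval1 oner_neq0. Qed.

Lemma isR_fmul u v : isR u -> isR v -> isR (fmul u v).
Proof. by rewrite /isR /= mevalM; apply: mulf_neq0. Qed.

Lemma Rideal_eq J u v : Rideal X J -> J u -> isR v -> u.1 * v.2 = v.1 * u.2 -> J v.
Proof.
case=> _ [_ [_ [_ H]]] Ju Rv E; apply: (H u) => //; exists 1.
by rewrite meval1 oner_neq0 E subrr mulr0; split=> //; apply: vanish0.
Qed.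

Lemma Rideal_fmul J u v : Rideal X J -> isR u -> J v -> J (fmul u v).
Proof. by case=> _ [_ [_ [H _]]]; apply: H. Qed.

Lemma Rideal_fadd J u v : Rideal X J -> J u -> J v -> J (fadd u v).
Proof. by case=> _ [_ [H _]]; apply: H. Qed.

Lemma Rideal_lideal J : Rideal X J -> lideal X (fun p => J (fpoly p)).
Proof.
move=> HJ; split.
- move=> p Hp; case: (HJ) => _ [J0 [_ [_ H]]]; apply: (H _ _ J0 (isR_fpoly p)).
  exists 1; rewrite meval1 oner_neq0 /= mul0r mulr1 sub0r mul1r; split=> //.
  exact: vanishN.
- move=> p q Hp Hq; apply: (Rideal_eq HJ (Rideal_fadd HJ Hp Hq) (isR_fpoly _)).
  by rewrite /= !mulr1.
- move=> p q Hq; apply: (Rideal_eq HJ (Rideal_fmul HJ (isR_fpoly p) Hq) (isR_fpoly _)).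
  by rewrite /= !mulr1.
- move=> h p h0 Hp.
  have Rh : isR ((1, h) : germ k N) by [].
  by apply: (Rideal_eq HJ (Rideal_fmul HJ Rh Hp) (isR_fpoly _)); rewrite /=; ring.
Qed.

Lemma Rideal_numE J u : Rideal X J -> isR u -> J u <-> J (fpoly u.1).
Proof.
move=> HJ Ru; split=> H.
  apply: (Rideal_eq HJ (Rideal_fmul HJ (isR_fpoly u.2) H) (isR_fpoly _)).
  by rewrite /=; ring.
have R1 : isR ((1, u.2) : germ k N) by [].
by apply: (Rideal_eq HJ (Rideal_fmul HJ R1 H) Ru); rewrite /=; ring.
Qed.

Lemma lideal_Rideal A : lideal X A -> Rideal X (fun u => isR u /\ A u.1).
Proof.
move=> HA; split; first by move=> u [].
split; first by split; [exact: isR_fpoly | apply: (lidealV HA); apply: vanish0].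
split=> [u v [Ru Au] [Rv Av]|].
  split; first exact: isR_fmul.
  by case: (HA) => _ HD _ _; apply: HD; rewrite mulrC; apply: (lidealM _ HA).
split=> [r u Rr [Ru Au]|u v [Ru Au] Rv [h [h0 Hh]]].
  by split; [exact: isR_fmul | apply: (lidealM _ HA)].
split=> //; apply: (lideal_unit HA h0); apply: (lideal_unit HA Ru).
have -> : u.2 * (h * v.1) = (h * v.2) * u.1 - h * (u.1 * v.2 - v.1 * u.2) by ring.
by apply: (lidealB HA); [apply: (lidealM _ HA) | apply: (lidealV HA)].
Qed.

Lemma lideal_full : lideal X (fun _ => True).
Proof. by []. Qed.

Lemma Rgen_Rideal (G : germ k N -> Prop) : (forall u, G u -> isR u) -> Rideal X (Rgen X G).
Proof.
move=> HG; split=> [u Hu|].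
  by have [] := Hu _ (lideal_Rideal lideal_full) (fun v Gv => conj (HG v Gv) Logic.I).
split=> [I [_ [H _]] //|]; split=> [u v Hu Hv I HI GI|].
  by apply: Rideal_fadd => //; [apply: Hu | apply: Hv].
split=> [r u Rr Hu I HI GI|u v Hu Rv E I HI GI].
  by apply: Rideal_fmul => //; apply: Hu.
by case: (HI) => _ [_ [_ [_ H]]]; apply: (H u) => //; apply: Hu.
Qed.

(** [Rgen] is an intersection of ideals: one direction tests it on the ideal of fractions with
    numerator in [lpow X f 1], the other contracts an arbitrary ideal to polynomials. *)
Lemma sys_idealE n (f : 'I_n -> S) u : sys_ideal X f u <-> isR u /\ lpow X f 1 u.1.
Proof.
split=> [H|[Ru H]].
  apply: (H _ (lideal_Rideal (lpow_lideal X f 1))) => _ [i ->].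
  by split; [exact: isR_fpoly | exact: lpow1].
move=> I HI GI; apply/(Rideal_numE HI Ru).
apply: (lpow_step (Rideal_lideal HI)) H => i q _.
apply: (lidealM _ (Rideal_lideal HI)); apply: GI.
by exists i.
Qed.

(** For the converse, a unit multiple of the numerator is a combination of the coordinates modulo
    [I(X)], and this congruence can be evaluated at [o] since [o] lies in [X]. *)
Lemma RmaxE u : Rmax u <-> isR u /\ lpow X xv 1 u.1.
Proof.
split=> -[Ru H]; split=> //; first exact: lpow_origin.
case: H => h h0 [q _ /(_ _ X0)]; rewrite mevalB mevalM.
have -> : (\sum_i q i * 'X_i).@[@origin k N] = 0.
  rewrite raddf_sum big1 // => i _; rewrite /= mevalM mevalXU; exact: mulr0.
by rewrite subr0 => /eqP; rewrite mulf_eq0 (negbTE h0) => /eqP.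
Qed.

Lemma RpowE n (f : 'I_n -> S) J : (forall u, J u <-> isR u /\ lpow X f 1 u.1) ->
  forall j u, Rpow X J j u <-> isR u /\ lpow X f j u.1.
Proof.
move=> HJ; elim=> [|j IH] u; first by split=> // -[].
split=> [H|[Ru H]].
  apply: (H _ (lideal_Rideal (lpow_lideal X f j.+1))) => _ [v [w [/IH[Rv Hv] [/HJ[Rw Hw] ->]]]].
  by split; [exact: isR_fmul | rewrite -addn1; apply: lpowM].
move=> I HI GI; apply/(Rideal_numE HI Ru).
apply: (lpow_step (Rideal_lideal HI)) H => i q Hq.
have GI' : I (fmul (fpoly q) (fpoly (f i))).
  apply: GI; exists (fpoly q), (fpoly (f i)); split; last split=> //.
    by apply/IH; split; first exact: isR_fpoly.
  by apply/HJ; split; [exact: isR_fpoly | exact: lpow1].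
by apply: (Rideal_eq HI GI' (isR_fpoly _)); rewrite /= !mulr1.
Qed.

Lemma isolated_rootE n (f : 'I_n -> S) : isolated_root X f <-> isol X f.
Proof.
have RmE := RpowE RmaxE.
split=> [[_ [s Hs]]|[s Hs]].
  exists s => p Hp; have [|_] := (sys_idealE f (fpoly p)).1 _; last by [].
  by apply: Hs; apply/RmE; split; first exact: isR_fpoly.
split; last by exists s => u /RmE[Ru /Hs Hu]; apply/sys_idealE.
by apply: Rgen_Rideal => _ [i ->]; exact: isR_fpoly.
Qed.

Lemma mprimary_lpow J : mprimary X J -> exists s, forall p, lpow X xv s p -> J (fpoly p).
Proof.
case=> _ [s Hs]; exists s => p Hp; apply: Hs; apply/(RpowE RmaxE).
by split; first exact: isR_fpoly.
Qed.

(** The fraction [u] and the polynomial [p] have the same class modulo [A], written without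
    division. *)
Definition gcong A u p := A (u.1 - p * u.2).

Lemma gcong_fpoly A p : lideal X A -> gcong A (fpoly p) p.
Proof. by move=> HA; rewrite /gcong /= mulr1 subrr; apply: (lidealV HA); apply: vanish0. Qed.

Lemma gcong_fadd A u v p q : lideal X A ->
  gcong A u p -> gcong A v q -> gcong A (fadd u v) (p + q).
Proof.
move=> HA Hu Hv; rewrite /gcong /=.
have -> : u.1 * v.2 + v.1 * u.2 - (p + q) * (u.2 * v.2)
  = v.2 * (u.1 - p * u.2) + u.2 * (v.1 - q * v.2) by ring.
by case: (HA) => _ HD HM _; apply: HD; apply: HM.
Qed.

Lemma gcong_fscale A u p c : lideal X A -> gcong A u p -> gcong A (fscale c u) (c *: p).
Proof.
move=> HA Hu; rewrite /gcong /= -scalerAl -scalerBr -mul_mpolyC.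
exact: (lidealM _ HA).
Qed.

Lemma gcong_lincomb A d (c : 'I_d -> k) (e : 'I_d -> germ k N) (e' : 'I_d -> S) :
  lideal X A -> (forall j, gcong A (e j) (e' j)) ->
  gcong A (lincomb c e) (\sum_j c j *: e' j).
Proof.
move=> HA He; rewrite /lincomb -big_enum /=; elim: (enum 'I_d) => [|j s IH] /=.
  by rewrite big_nil; apply: gcong_fpoly.
by rewrite big_cons; apply: gcong_fadd => //; apply: gcong_fscale.
Qed.

Lemma gcongE A u p : lideal X A -> isR u -> gcong A u p -> A u.1 <-> A p.
Proof.
move=> HA Ru Hu; split=> H.
  apply: (lideal_unit HA Ru); rewrite mulrC.
  have -> : p * u.2 = u.1 - (u.1 - p * u.2) by ring.
  by apply: (lidealB HA).
by apply: (lideal_iff HA Hu); rewrite mulrC; apply: (lidealM _ HA).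
Qed.

Lemma isR_lincomb d (c : 'I_d -> k) (e : 'I_d -> germ k N) :
  (forall j, isR (e j)) -> isR (lincomb c e).
Proof.
move=> He; rewrite /lincomb; elim: (enum 'I_d) => [|j s IH] /=; first exact: isR_fpoly.
by apply: isR_fmul => //; apply: He.
Qed.

Lemma gcong_exists A s u : lideal X A -> (forall p, lpow X xv s p -> A p) ->
  isR u -> exists p, gcong A u p.
Proof.
move=> HA Hs Ru; have [h H] := lideal_inverse HA Hs Ru; exists (u.1 * h).
by rewrite /gcong -mulrA -{1}[u.1]mulr1 -mulrBr; apply: (lidealM _ HA).
Qed.

(** Modulo an ideal containing a power of the maximal ideal every denominator has a polynomial
    inverse, so bases of [R / J] and of [k[x] / A] correspond through [gcong]. *)
Lemma quot_dimE J A s d : (forall u, J u <-> isR u /\ A u.1) -> lideal X A ->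
  (forall p, lpow X xv s p -> A p) -> quot_dim X J d <-> codim A d.
Proof.
move=> HJ HA Hs; split=> [[e [Re [ie se]]]|[e [se ie]]].
  pose e' j := epsilon (inhabits 0) (gcong A (e j)).
  have He j : gcong A (e j) (e' j) by apply: epsilon_spec; apply: gcong_exists Hs (Re j).
  exists e'; split=> [p|c Hc].
    have [c /HJ[_ Hc]] := se _ (isR_fpoly p); exists c.
    move/gcongE: Hc => /(_ (p + (-1) *: \sum_j c j *: e' j) HA); rewrite scaleN1r; apply.
      by apply: isR_fmul; [exact: isR_fpoly | exact: isR_lincomb].
    rewrite -scaleN1r; apply: gcong_fadd => //; first exact: gcong_fpoly.
    by apply: gcong_fscale => //; apply: gcong_lincomb.
  apply: ie; apply/HJ; split; first exact: isR_lincomb.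
  by apply/(gcongE HA (isR_lincomb c Re) (gcong_lincomb c HA He)).
have Re j : isR (fpoly (e j)) by exact: isR_fpoly.
have He j : gcong A (fpoly (e j)) (e j) by exact: gcong_fpoly.
exists (fun j => fpoly (e j)); split=> //; split=> [c /HJ[_ Hc]|u Ru].
  by apply: ie; apply/(gcongE HA (isR_lincomb c Re) (gcong_lincomb c HA He)).
have [p Hp] := gcong_exists HA Hs Ru; have [c Hc] := se p; exists c.
have Rs : isR (fsub u (lincomb c (fun j => fpoly (e j)))).
  by apply: isR_fmul => //; exact: isR_lincomb.
apply/HJ; split=> //.
apply/(@gcongE _ _ (p + (-1) *: \sum_j c j *: e j) HA Rs); last by rewrite scaleN1r.
apply: gcong_fadd => //; apply: gcong_fscale => //; exact: gcong_lincomb.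
Qed.

Lemma isol_qdim n (f : 'I_n -> S) j : isol X f -> codim (lpow X f j) (qdim X (Rpow X (sys_ideal X f) j)).
Proof.
move=> Hf; have [s Hs] := isol_pow j Hf.
have E d := quot_dimE d (RpowE (sys_idealE f) j) (lpow_lideal X f j) Hs.
apply/E; apply: epsilon_spec; have [d Hd] := codim_exists j Hf.
by exists d; apply/E.
Qed.

Lemma multiplicity n (f : 'I_n -> S) : isol X f -> exists r C,
  mult_is X f (INR r) /\
  forall K L, (0 < K)%N -> codim (lpow X (fun i => f i ^+ K) 1) L ->
    (r * K ^ n <= L)%N /\ (K * L <= K * (r * K ^ n) + C * K ^ n)%N.
Proof.
move=> Hf; have [r [C H]] := multiplicity_bounds Hf; exists r, C; split.
  pose a K := (n`! * qdim X (Rpow X (sys_ideal X f) K))%N.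
  have : forall K, (0 < K)%N -> (r * K ^ n <= a K)%N /\ (K * a K <= K * (r * K ^ n) + C * K ^ n)%N.
    by move=> K K0; have [Ha _] := H K K0; apply: Ha; apply: isol_qdim.
  move/Un_cv_of_bounds => Hcv eps /Hcv[M HM]; exists M => j /HM.
  by rewrite /a RIneq.mult_INR.
by move=> K L K0; have [_ Hb] := H K K0; apply: Hb.
Qed.

End Germs.

(** * Openness *)

Section Coordinates.
Context (k : fieldType) (E : lmodType k).
Implicit Types A : E -> Prop.

(** Coordinates are chosen by [epsilon]; independence makes them unique, and uniqueness makes the
    choice linear. *)
Lemma exists_coordinates A d (b : 'I_d -> E) : subspace A -> spans A b -> indep A b ->
  exists co : E -> 'rV[k]_d,
    [/\ forall u v, co (u + v) = co u + co v, forall c u, co (c *: u) = c *: co u,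
        forall u, co u = 0 <-> A u & forall r, exists u, co u = r].
Proof.
move=> HA sb ib; case: (HA) => A0 AD AZ.
have uniq (r r' : 'rV[k]_d) u : A (u - \sum_j r 0 j *: b j) -> A (u - \sum_j r' 0 j *: b j) -> r = r'.
  move=> H H'; apply/rowP => j; apply/eqP; rewrite -subr_eq0; apply/eqP.
  apply: (ib (fun j => r 0 j - r' 0 j) _ j).
  under eq_bigr do rewrite scalerBl.
  rewrite sumrB; set x := \sum_j _ in H *; set y := \sum_j _ in H' *.
  have -> : x - y = (u - y) - (u - x) by rewrite opprB [RHS]addrC addrA subrK.
  exact: subspaceB.
pose co u := epsilon (inhabits 0) (fun r : 'rV[k]_d => A (u - \sum_j r 0 j *: b j)).
have coP u : A (u - \sum_j co u 0 j *: b j).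
  apply: (epsilon_spec (inhabits 0) (fun r : 'rV[k]_d => A (u - \sum_j r 0 j *: b j))).
  have [c Hc] := sb u; exists (\row_j c j).
  by under eq_bigr do rewrite mxE.
exists co; split.
- move=> u v; apply: (uniq _ _ _ (coP _)); under eq_bigr do rewrite mxE scalerDl.
  by rewrite big_split /= opprD addrACA; apply: AD.
- move=> c u; apply: (uniq _ _ _ (coP _)); under eq_bigr do rewrite mxE -scalerA.
  by rewrite -scaler_sumr -scalerBr; apply: AZ.
- move=> u; split=> [E0|Au].
    have := coP u; rewrite E0 big1 ?subr0 // => j _; rewrite mxE; exact: scale0r.
  apply: (uniq _ _ _ (coP u)); rewrite big1 ?subr0 // => j _; rewrite mxE; exact: scale0r.
- move=> r; exists (\sum_j r 0 j *: b j); apply: (uniq _ _ _ (coP _)).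
  by rewrite subrr.
Qed.

End Coordinates.

Section Openness.
Context (k : closedFieldType) (N : nat) (X : aset k N) (n : nat).
Local Notation S := {mpoly k[N]}.
Local Notation xv := (fun i : 'I_N => 'X_i : S).
Implicit Types (A B : S -> Prop) (p : S) (f g : 'I_n -> S).

(** The subspaces [A + m^i], for [i] from [0] to [s + 1], cannot drop strictly at all [s + 1] steps,
    since the last one has codimension at most [L <= s]. A step without a drop puts [m^i] in
    [A + m^(i+1)], and [nakayama] then puts it in [A]. *)
Lemma spans_modulo_isol A s L (e : 'I_L -> S) : lideal X A -> (L <= s)%N ->
  (forall p, exists2 a, A a & exists c : 'I_L -> k, lpow X xv s.+1 (p - a - \sum_j c j *: e j)) ->
  (forall p, lpow X xv s p -> A p) /\ spans A e.
Proof.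
move=> HA Ls He.
pose B i p := exists2 a, A a & lpow X xv i (p - a).
have HB i : subspace (B i).
  case: (lideal_subspace HA) (lideal_subspace (lpow_lideal X xv i)) => A0 AD AZ [M0 MD MZ]; split.
  - by exists 0 => //; rewrite subrr.
  - by move=> u v [a Aa Hu] [a' Aa' Hv]; exists (a + a'); [exact: AD | rewrite opprD addrACA; exact: MD].
  - by move=> c u [a Aa Hu]; exists (c *: a); [exact: AZ | rewrite -scalerBr; exact: MZ].
have AB i p : A p -> B i p.
  by move=> Ap; exists p => //; rewrite subrr; apply: (lidealV (lpow_lideal _ _ _)); exact: vanish0.
have MB i p : lpow X xv i p -> B i p.
  by move=> Ap; exists 0; [case: (lideal_subspace HA) | rewrite subr0].
suff Hs : forall p, lpow X xv s p -> A p.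
  split=> // p; have [a Aa [c Hc]] := He p; exists c.
  apply: (lideal_iff HA (q := a)) => //; rewrite addrAC; apply: Hs; exact: lpow_decr1.
have [i [le Hi]] : exists i, (i <= s)%N /\ forall p, lpow X xv i p -> B i.+1 p.
  apply: NNPP => Hn.
  have Hp (i : 'I_s.+1) : exists p, lpow X xv i p /\ ~ B i.+1 p.
    apply: NNPP => Hi; apply: Hn; exists i; split; first by rewrite -ltnS.
    by move=> p Mp; apply: NNPP => Bp; apply: Hi; exists p.
  (* One witness per strict drop. They are independent modulo [A + m^(s+1)]: in a relation, the
     nonzero coefficient of least index [i] would put [q i] in [A + m^(i+1)]. *)
  pose q (i : 'I_s.+1) := epsilon (inhabits 0) (fun p => lpow X xv i p /\ ~ B i.+1 p).
  have Hq (i : 'I_s.+1) : lpow X xv i (q i) /\ ~ B i.+1 (q i) by apply: (epsilon_spec (inhabits 0) (fun p => lpow X xv i p /\ ~ B i.+1 p)); apply: Hp.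
  have sB : spans (B s.+1) e.
    by move=> p; have [a Aa [c Hc]] := He p; exists c; exists a => //; rewrite addrAC.
  have iB : indep (B s.+1) q.
    move=> c Hc; suff H t : forall i : 'I_s.+1, i = t :> nat -> c i = 0 by move=> i; apply: (H i).
    elim/ltn_ind: t => t IH i Ei; apply/eqP/negPn/negP => ci.
    case: (Hq i) => _; apply.
    have -> : q i = (c i)^-1 *: (\sum_j c j *: q j - \sum_(j | j != i) c j *: q j).
      by rewrite (bigD1 i) //= addrK scalerA mulVf // scale1r.
    case: (HB i.+1) => _ _; apply; apply: subspaceB => //.
      case: Hc => a Aa Ha; exists a => //; by apply: (lpow_decr _ Ha); apply: ltn_ord.
    apply: subspace_sum => // j ne; have [lt|ge] := ltnP j i.
      by rewrite (IH j) -?Ei // scale0r; case: (HB i.+1).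
    case: (HB i.+1) => _ _; apply; apply: MB; apply: (@lpow_decr _ _ _ _ _ _ j).
      by rewrite ltn_neqAle ge andbT eq_sym.
    by case: (Hq j).
  have := indep_le_spans (HB s.+1) sB iB; rewrite !card_ord => H.
  by have := leq_trans H Ls; rewrite ltnn.
move=> p /(lpow_decr le); apply: nakayama => // p' /Hi[a Aa Ha]; by exists a.
Qed.

Section Minors.
Context (m K s L : nat) (e : 'I_L -> S).
Local Notation Q := #|{: coef_index N n m}|.
Local Notation C := {mpoly k[Q]}.
Local Notation T := ('I_L + 'X_{1..N < s.+1} * 'I_n)%type.

(** The coefficients are indeterminates, one per coordinate on the space of systems, so that minors
    built from them are polynomials on that space. *)
Definition generic_poly (i : 'I_n) : {mpoly C[N]} :=
  \sum_(a : 'X_{1..N < m.+1}) ('X_(enum_rank (i, a)) : C) *: 'X_[a].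

Lemma generic_polyE f i : (msize (f i) <= m.+1)%N ->
  map_mpoly (meval (@coords k N n m f)) (generic_poly i) = f i.
Proof.
move=> Hf; rewrite [RHS](mpolywE Hf) raddf_sum /=; apply: eq_bigr => a _.
by rewrite map_mpolyZ map_mpolyX /= mevalXU /coords enum_rankK.
Qed.

(** Multipliers of degree at most [s] suffice modulo [m^(s+1)], so finitely many rows generate the
    sum of the span of [e] and the ideal of the [f_i ^+ K]. *)
Definition srow f (t : T) : S :=
  match t with inl i => e i | inr bi => 'X_[bi.1] * f bi.2 ^+ K end.

Definition generic_row (t : T) : {mpoly C[N]} :=
  match t with
  | inl i => map_mpoly (@mpolyC Q k) (e i)
  | inr bi => 'X_[bi.1] * generic_poly bi.2 ^+ K
  end.

Lemma generic_rowE f t : (forall i, msize (f i) <= m.+1)%N ->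
  map_mpoly (meval (@coords k N n m f)) (generic_row t) = srow f t.
Proof.
move=> Hf; case: t => [i|[a i]] /=.
  by apply/mpolyP => a; rewrite !mcoeff_map_mpoly /= mevalC.
by rewrite rmorphM rmorphXn /= map_mpolyX generic_polyE.
Qed.

Context (d : nat) (co : S -> 'rV[k]_d).
Hypothesis coD : forall u v, co (u + v) = co u + co v.
Hypothesis coZ : forall c u, co (c *: u) = c *: co u.
Hypothesis co0 : forall u, co u = 0 <-> lpow X xv s.+1 u.
Hypothesis co_surj : forall r, exists u, co u = r.

Lemma co_sum (J : Type) (r : seq J) (P : pred J) (F : J -> S) :
  co (\sum_(j <- r | P j) F j) = \sum_(j <- r | P j) co (F j).
Proof.
apply: (big_morph co coD); apply/co0/(lidealV (lpow_lideal _ _ _)); exact: vanish0.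
Qed.

Lemma co_eq u v : lpow X xv s.+1 (u - v) -> co u = co v.
Proof. by move=> /co0 H; rewrite -[u](subrK v) coD H add0r. Qed.

Definition rows f : 'M[k]_(#|{: T}|, d) := \matrix_t co (srow f (enum_val t)).

Definition generic_rows : 'M[C]_(#|{: T}|, d) :=
  \matrix_(t, j) \sum_(a <- msupp (generic_row (enum_val t)))
     (generic_row (enum_val t))@_a * (co 'X_[a] 0 j)%:MP.

Lemma generic_rowsE f : (forall i, msize (f i) <= m.+1)%N ->
  map_mx (meval (@coords k N n m f)) generic_rows = rows f.
Proof.
move=> Hf; apply/matrixP => t j; rewrite !mxE raddf_sum /=.
rewrite -(generic_rowE _ Hf) /map_mpoly /mmap co_sum summxE; apply: eq_bigr => a _.
by rewrite mevalM mevalC mmap1_id /= mul_mpolyC coZ mxE.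
Qed.

Lemma rows_full g : spans (lpow X (fun i => g i ^+ K) 1) e -> row_full (rows g).
Proof.
move=> He; rewrite -sub1mx; apply/row_subP => j.
have [p <-] := co_surj (row j 1%:M).
have subD u v : (co u <= rows g -> co v <= rows g -> co (u + v) <= rows g)%MS.
  by rewrite coD; apply: addmx_sub.
have subZ c u : (co u <= rows g -> co (c *: u) <= rows g)%MS.
  by rewrite coZ; apply: scalemx_sub.
have subG t : (co (srow g t) <= rows g)%MS.
  by have := row_sub (enum_rank t) (rows g); rewrite rowK enum_rankK.
have subS (J : finType) (F : J -> S) :
    (forall j, (co (F j) <= rows g)%MS) -> (co (\sum_j F j) <= rows g)%MS.
  by move=> HF; rewrite co_sum; apply: summx_sub.
have [c Hc] := He p; rewrite -[p](subrK (\sum_j0 c j0 *: e j0)).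
apply: subD; last by apply: subS => i; apply: subZ; apply: (subG (inl i)).
case: Hc => h h0 [q _ Hv]; move: (p - _) Hv => a Hv.
have Ms := lpow_lideal X xv s.+1.
have [h' Hh'] := lideal_scale a Ms (fun p H => H) h0.
rewrite (co_eq Hh').
have -> : co (h' * (h * a)) = co (\sum_i h' * q i * g i ^+ K).
  apply: co_eq; under eq_bigr do rewrite -mulrA.
  by rewrite -mulr_sumr -mulrBr; apply: (lidealM _ Ms); apply: (lidealV Ms).
apply: (subS) => i; have [c' Hc'] := spans_monomials Ms (fun p H => H) (h' * q i).
have -> : co (h' * q i * g i ^+ K)
    = co (\sum_(b : 'X_{1..N < s.+1}) c' b *: ('X_[b] * g i ^+ K)).
  apply: co_eq; under eq_bigr do rewrite scalerAl.
  by rewrite -mulr_suml -mulrBl mulrC; apply: (lidealM _ Ms).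
by apply: subS => b; apply: subZ; apply: (subG (inr (b, i))).
Qed.

Lemma full_rows f : row_full (rows f) ->
  forall p, exists2 a, lpow X (fun i => f i ^+ K) 1 a &
    exists c : 'I_L -> k, lpow X xv s.+1 (p - a - \sum_j c j *: e j).
Proof.
move=> Hf p; have /submxP[D HD] := submx_full (co p) Hf.
exists (\sum_(bi : 'X_{1..N < s.+1} * 'I_n) D 0 (enum_rank (inr bi)) *: srow f (inr bi)).
  apply: (lideal_sum (lpow_lideal _ _ _)) => -[b i] _.
  rewrite -mul_mpolyC mulrA; apply: lidealM => //; exact: (lpow1 X (fun i => f i ^+ K)).
exists (fun j => D 0 (enum_rank (inl j))); apply/co0.
have E : co p = \sum_(t : T) D 0 (enum_rank t) *: co (srow f t).
  rewrite HD mulmx_sum_row (reindex (@enum_rank T)) /=; last exact: (onW_bij _ (enum_rank_bij T)).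
  by apply: eq_bigr => t _; rewrite rowK enum_rankK.
rewrite -addrA -opprD coD -scaleN1r coZ coD !co_sum E big_sumType /= scaleN1r.
under [X in X + _ - _]eq_bigr do rewrite -coZ.
under [X in _ + X - _]eq_bigr do rewrite -coZ.
by rewrite [X in _ - X]addrC subrr.
Qed.

End Minors.

(** [h] is a maximal minor of the generic rows, chosen nonzero at [g]. Where it does not vanish, the
    basis [e] found for [g] still spans modulo [(f^K) + m^(L+1)], which gives isolation and the
    colength bound together. The rows, hence [h], depend only on the classes of the [f_i] in [R];
    this is what makes the open set saturated. *)
Lemma semicontinuity g m K L : isol X g -> (forall i, msize (g i) <= m.+1)%N ->
  (0 < K)%N -> codim (lpow X (fun i => g i ^+ K) 1) L ->
  exists h : {mpoly k[#|{: coef_index N n m}|]},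
  [/\ h.@[@coords k N n m g] != 0,
      forall f, (forall i, msize (f i) <= m.+1)%N -> h.@[@coords k N n m f] != 0 ->
        isol X f /\ forall L', codim (lpow X (fun i => f i ^+ K) 1) L' -> (L' <= L)%N &
      forall f f', (forall i, msize (f i) <= m.+1)%N -> (forall i, msize (f' i) <= m.+1)%N ->
        (forall i, Req X (fpoly (f i)) (fpoly (f' i))) ->
        h.@[@coords k N n m f] = h.@[@coords k N n m f']].
Proof.
(* The smallest order that [spans_modulo_isol] allows for [L] vectors. *)
move=> Hg mg K0 [e [se _]]; pose s := L.
have Ms := lpow_lideal X xv s.+1.
have [d [b [sb ib]]] := exists_basis Ms (fun p H => H).
have [co [coD coZ co0 co_surj]] := exists_coordinates (lideal_subspace Ms) sb ib.
have Fg := rows_full coD coZ co0 co_surj se.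
pose h := \det (rowsub (fullrankfun Fg) (generic_rows m K s e co)).
have hE f : (forall i, msize (f i) <= m.+1)%N ->
    h.@[@coords k N n m f] = \det (rowsub (fullrankfun Fg) (rows K s e co f)).
  move=> mf; rewrite /h -det_map_mx; congr (\det _).
  by rewrite -(generic_rowsE K e coD coZ co0 mf); apply/matrixP => i j; rewrite !mxE.
exists h; split.
- by rewrite hE // -unitfE -unitmxE fullrowsub_unit.
- move=> f mf; rewrite hE // => hf.
  have Ff : row_full (rows K s e co f).
    have : row_full (rowsub (fullrankfun Fg) (rows K s e co f)) by rewrite row_full_unit unitmxE unitfE.
    rewrite -!sub1mx => H; apply: (submx_trans H).
    by apply/row_subP => i; rewrite row_rowsub row_sub.
  have [H1 H2] := spans_modulo_isol (lpow_lideal X (fun i => f i ^+ K) 1) (leqnn L)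
     (full_rows coD coZ co0 Ff).
  split.
    exists s => p /H1 /lpow_of_frob; rewrite muln1; exact: lpow_decr.
  by move=> L' HL'; have := codim_le_spans (lpow_lideal _ _ _) HL' H2; rewrite card_ord.
- move=> f f' mf mf' Hff; rewrite !hE //; congr (\det (rowsub _ _)).
  apply/matrixP => t j; rewrite !mxE; congr (fun_of_matrix _ _ _); apply: (co_eq coD co0).
  case: (enum_val t) => [i|[a i]] /=.
    by rewrite subrr; apply: (lidealV Ms); exact: vanish0.
  rewrite -mulrBr subrXX -[(f i - _) * _]mulrC; do 2!apply: (lidealM _ Ms).
  have [u [u0 Hu]] := Hff i; apply: (lideal_unit Ms u0); apply: (lidealV Ms).
  by move: Hu; rewrite /= !mulr1.
Qed.

End Openness.

(** * Zorn's lemma and weights *)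

(** [Zorn_bigcup] also ranges over the empty chain, whose union is empty; [P'] therefore admits the
    empty predicate, and the element [t0] of [A0] prevents it from being maximal. *)
Lemma zorn_pred (T : Type) (P : (T -> Prop) -> Prop) (A0 : T -> Prop) (t0 : T) :
  A0 t0 -> P A0 ->
  (forall F : (T -> Prop) -> Prop, (exists A, F A) ->
     (forall A, F A -> P A) ->
     (forall A B, F A -> F B -> (forall t, A t -> B t) \/ (forall t, B t -> A t)) ->
     P (fun t => exists2 A, F A & A t)) ->
  exists A, [/\ P A, forall t, A0 t -> A t &
    forall B, P B -> (forall t, A t -> B t) -> forall t, B t -> A t].
Proof.
move=> A00 PA0 chain.
pose P' (A : T -> Prop) := (forall t, ~ A t) \/ (P A /\ forall t, A0 t -> A t).
have [F FP tot|A [PA maxA]] := @classical_sets.Zorn_bigcup T P'.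
  have [[A [FA [t At]]]|H] := classic (exists A, F A /\ exists t, A t); last first.
    by left => t [A FA At]; apply: H; exists A; split=> //; exists t.
  pose F' (B : T -> Prop) := F B /\ exists t, B t.
  have F'P B : F' B -> P B /\ forall t, A0 t -> B t.
    by case=> /FP[H|//] [u Bu]; case: (H u).
  have E : classical_sets.bigcup F id = (fun t => exists2 A, F' A & A t).
    apply: boolp.funext => u; apply: boolp.propext; split=> [[B FB Bu]|[B [FB _] Bu]].
      by exists B => //; split=> //; exists u.
    by exists B.
  rewrite E; right; split.
    apply: chain; [by exists A; split=> //; exists t|by move=> B /F'P[]|].
    by move=> B C [FB _] [FC _]; apply: tot.
  by move=> u Au; exists A; [split=> //; exists t | apply: (proj2 (F'P A _)) => //; split=> //; exists t].
have PropA B : P' B -> (forall t, A t -> B t) -> forall t, B t -> A t.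
  move=> PB AB t Bt; apply: NNPP => At; apply: (maxA B _ PB).
  by split=> // BA; apply: At; apply: BA.
case: PA => [A0'|[PA H]].
  by case: (A0' t0); apply: (PropA A0) => //; [right | move=> t /A0'].
exists A; split=> // B PB AB; apply: PropA => //; right; split=> // t /H; exact: AB.
Qed.

Section Weights.
Local Open Scope nat_scope.

Definition weight d B (m : 'X_{1..d}) := \sum_(i < d) m i * B ^ i.

Lemma weight_inj d B (m m' : 'X_{1..d}) : (forall i, m i < B) -> (forall i, m' i < B) ->
  weight B m = weight B m' -> m = m'.
Proof.
suff H (f g : nat -> nat) : (forall i, f i < B) -> (forall i, g i < B) ->
    \sum_(i < d) f i * B ^ i = \sum_(i < d) g i * B ^ i -> forall i, i < d -> f i = g i.
  move=> Hm Hm' E; apply/mnmP => i.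
  have B0 : 0 < B by apply: leq_ltn_trans (Hm i).
  pose ext (m : 'X_{1..d}) j := if insub j is Some i then m i else 0.
  have extE (m0 : 'X_{1..d}) (l : 'I_d) : ext m0 l = m0 l by rewrite /ext valK.
  have extB (m0 : 'X_{1..d}) : (forall l, m0 l < B) -> forall j, ext m0 j < B.
    by move=> Hm0 j; rewrite /ext; case: insubP.
  have := H _ _ (extB _ Hm) (extB _ Hm') _ i (ltn_ord i); rewrite !extE; apply.
  under eq_bigr do rewrite extE.
  by rewrite -/(weight B m) E; apply: eq_bigr => l _; rewrite extE.
clear m m'; elim: d f g => [//|d IH] f g Hf Hg.
rewrite !big_ord_recl /= !expn0 !muln1.
have E (h : nat -> nat) : \sum_(i < d) h (bump 0 i) * B ^ bump 0 i = B * \sum_(i < d) h i.+1 * B ^ i.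
  by rewrite big_distrr /=; apply: eq_bigr => i _; rewrite /bump /= add1n expnS mulnCA.
rewrite !E => {}E.
have B0 : 0 < B by apply: leq_ltn_trans (Hf 0).
have f0 : f 0 = g 0.
  by have := congr1 (fun x => x %% B) E; rewrite ![f 0 + _]addnC ![g 0 + _]addnC ![B * _]mulnC !modnMDl !modn_small.
move: E; rewrite f0 => /addnI /eqP; rewrite eqn_mul2l eqn0Ngt B0 /= => /eqP E [_|i lt] //.
exact: (IH (fun i => f i.+1) (fun i => g i.+1)).
Qed.

End Weights.

Section WeightedSubstitution.
Context (k : fieldType) (A : idomainType) (c : {rmorphism k -> A}) (d B : nat).
Context (G : 'I_d -> {poly A}).
Hypothesis Gmonic : forall i, G i \is monic.
Hypothesis Gsize : forall i, size (G i) = (B ^ i).+1.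

Lemma mmap1_weight m : mmap1 G m \is monic /\ size (mmap1 G m) = (weight B m).+1.
Proof.
have exp p w e : p \is monic -> size p = w.+1 ->
    p ^+ e \is monic /\ size (p ^+ e : {poly A}) = (e * w).+1.
  move=> Mp Sp; split; first exact: monic_exp.
  rewrite -[LHS]prednK; first by rewrite size_exp Sp mulnC.
  by rewrite lt0n size_poly_eq0 monic_neq0 // monic_exp.
rewrite /mmap1 /weight.
apply: (big_ind2 (fun (p : {poly A}) w => p \is monic /\ size p = w.+1)).
- by rewrite monic1 size_poly1.
- move=> p w q w' [Mp Sp] [Mq Sq]; rewrite monicMl // Mq; split=> //.
  by rewrite size_monicM ?monic_neq0 // Sp Sq addSn addnS.
- by move=> i _; apply: exp.
Qed.

(** [B] exceeds every exponent in [q], so by uniqueness of base-[B] digits its monomials have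
    distinct weights. Exactly one of them reaches the top degree [W], where nothing can cancel; [a]
    is its coefficient. *)
Lemma weighted_lead (q : {mpoly k[d]}) : q != 0 -> B = msize q ->
  exists W a, [/\ a != 0, (size (mmap (polyC \o c) G q) <= W.+1)%N &
    (mmap (polyC \o c) G q)`_W = c a].
Proof.
move=> q0 EB.
have [m0 m0q max] : exists2 m0, m0 \in msupp q & forall m, m \in msupp q ->
    (weight B m <= weight B m0)%N.
  have : msupp q != [::] by rewrite msupp_eq0.
  elim: (msupp q) => [//|m s IH] _; have [->|/IH[m1 m1s H]] := eqVneq s [::].
    by exists m; rewrite ?inE // => m'; rewrite inE => /eqP ->.
  have [le|lt] := leqP (weight B m1) (weight B m).
    exists m; first by rewrite inE eqxx.
    by move=> m'; rewrite inE => /orP[/eqP ->//|/H H']; apply: leq_trans le.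
  exists m1; first by rewrite inE m1s orbT.
  by move=> m'; rewrite inE => /orP[/eqP ->|/H //]; apply: ltnW.
have bd m : m \in msupp q -> forall i, (m i < B)%N.
  move=> /msize_mdeg_lt; rewrite -EB => lt i; apply: leq_ltn_trans lt.
  by rewrite mdegE (bigD1 i) //= leq_addr.
exists (weight B m0), q@_m0; split; first by rewrite -mcoeff_msupp.
  apply/leq_sizeP => j Hj; rewrite /mmap coef_sum big_seq big1 // => m mq.
  rewrite /= coefCM nth_default ?mulr0 //; case: (mmap1_weight m) => _ ->.
  by apply: leq_trans Hj; rewrite ltnS max.
rewrite /mmap coef_sum (bigD1_seq m0) ?msupp_uniq //= coefCM.
have [M0 S0] := mmap1_weight m0.
have -> : (mmap1 G m0)`_(weight B m0) = 1.
  by move/monicP: M0; rewrite lead_coefE S0.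
rewrite mulr1 big_seq_cond big1 ?addr0 // => m /andP[mq ne].
rewrite coefCM nth_default ?mulr0 //; case: (mmap1_weight m) => _ ->.
rewrite ltn_neqAle max // andbT; apply: contra ne => /eqP E; apply/eqP.
exact: weight_inj (bd _ mq) (bd _ m0q) E.
Qed.

End WeightedSubstitution.

(** Kronecker substitution [x_i = t^(B^i)] reduces the claim to one variable. *)
Lemma mpoly_nonroot (k : closedFieldType) d (q : {mpoly k[d]}) :
  q != 0 -> exists x, q.@[x] != 0.
Proof.
move=> q0; pose B := msize q.
have [|i|W [a [a0 _ Ha]]] :=
    @weighted_lead k k idfun d B (fun i => 'X^(B ^ i)) _ _ q q0 (erefl _).
- by move=> i; apply: monicXn.
- by rewrite size_polyXn.
have nz : mmap (polyC \o idfun) (fun i : 'I_d => 'X^(B ^ i)) q != 0.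
  by apply: contra a0 => /eqP E; move: Ha; rewrite E coef0 => /esym/eqP.
have [t Ht] := closed_nonrootP _ nz.
exists (fun i => t ^+ (B ^ i)); apply: contra Ht; rewrite /root => /eqP <-.
rewrite /mmap mevalE horner_sum; apply/eqP; apply: eq_bigr => m _ /=.
rewrite hornerCM /mmap1 horner_prod; congr (_ * _); apply: eq_bigr => i _.
by rewrite horner_exp hornerXn.
Qed.

(** * Prime ideals, going up, Nullstellensatz *)

Section Ideals.
Context (A : comNzRingType).
Implicit Types P : A -> Prop.

Definition pideal P :=
  [/\ P 0, forall p q, P p -> P q -> P (p + q) & forall p q, P q -> P (p * q)].

Definition pprime P := [/\ pideal P, ~ P 1 & forall p q, P (p * q) -> P p \/ P q].

Lemma pidealM P p q : pideal P -> P q -> P (p * q).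
Proof. by case=> _ _; apply. Qed.

Lemma pidealN P p : pideal P -> P p -> P (- p).
Proof. by move=> HP Pp; rewrite -mulN1r; apply: pidealM. Qed.

Lemma pidealB P p q : pideal P -> P p -> P q -> P (p - q).
Proof. by move=> HP Pp Pq; case: (HP) => _ HD _; apply: HD => //; apply: pidealN. Qed.

Lemma pideal_iff P p q : pideal P -> P (p - q) -> P q -> P p.
Proof. by case=> _ HD _ Ppq Pq; rewrite -(subrK q p); apply: HD. Qed.

Lemma pideal_sum P (J : Type) {r : seq J} (Q : pred J) (F : J -> A) :
  pideal P -> (forall j, Q j -> P (F j)) -> P (\sum_(j <- r | Q j) F j).
Proof. by case=> H0 HD _ HF; apply: (big_ind P). Qed.

Lemma pprime_prod P (J : Type) {r : seq J} (F : J -> A) :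
  pprime P -> P (\prod_(j <- r) F j) -> exists j, P (F j).
Proof.
case=> _ P1 PM; elim: r => [|j r IH]; first by rewrite big_nil.
by rewrite big_cons => /PM[|/IH //]; exists j.
Qed.

(** An ideal maximal among those disjoint from [T] is prime: adjoining [p] or [q] outside it
    produces an element of [T] each time, and the product of the two would lie in the ideal if
    [p * q] did. *)
Lemma exists_prime_avoiding P (T : A -> Prop) : pideal P -> T 1 ->
  (forall p q, T p -> T q -> T (p * q)) -> (forall p, P p -> ~ T p) ->
  exists P', [/\ pprime P', forall p, P p -> P' p & forall p, P' p -> ~ T p].
Proof.
move=> HP T1 TM PT; pose good Q := pideal Q /\ forall p, Q p -> ~ T p.
have [||F [Q0 FQ0] FP tot|M [[HM MT] PM maxM]] := @zorn_pred A good P 0.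
- by case: HP.
- by [].
- split; last by move=> p [Q FQ Qp]; case: (FP Q FQ) => _ /(_ p Qp).
  split.
  + by exists Q0 => //; case: (FP _ FQ0) => -[].
  + move=> p q [Q FQ Qp] [Q' FQ' Qq]; have [sub|sub] := tot _ _ FQ FQ'.
      by exists Q' => //; case: (FP _ FQ') => -[_ HD _] _; apply: HD => //; apply: sub.
    by exists Q => //; case: (FP _ FQ) => -[_ HD _] _; apply: HD => //; apply: sub.
  + by move=> p q [Q FQ Qq]; exists Q => //; case: (FP _ FQ) => HQ _; apply: pidealM.
exists M; split=> //; split=> //; first by move=> /MT.
have key p : ~ M p -> exists a b, M a /\ T (a + b * p).
  move=> Mp; apply: NNPP => Hn; apply: Mp.
  apply: (maxM (fun x => exists a b, M a /\ x = a + b * p)).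
  - split; last by move=> _ [a [b [Ma ->]]] Tx; apply: Hn; exists a, b.
    split.
    + by exists 0, 0; rewrite mul0r addr0; case: HM.
    + move=> _ _ [a [b [Ma ->]]] [a' [b' [Ma' ->]]]; exists (a + a'), (b + b').
      by rewrite mulrDl addrACA; case: (HM) => _ HD _; split=> //; apply: HD.
    + move=> x _ [a [b [Ma ->]]]; exists (x * a), (x * b).
      by rewrite mulrDr mulrA; split=> //; apply: pidealM.
  - by move=> x Mx; exists x, 0; rewrite mul0r addr0.
  - by exists 0, 1; rewrite mul1r add0r; case: HM.
move=> p q Mpq; apply: NNPP => /not_or_and[/key[a [b [Ma Ta]]] /key[a' [b' [Ma' Ta']]]].
apply: (MT _ _ (TM _ _ Ta Ta')).
have -> : (a + b * p) * (a' + b' * q) = (a' + b' * q) * a + (b * p) * a' + (b * b') * (p * q) by ring.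
by case: (HM) => _ HD HMM; apply: (HD); [apply: (HD)|]; apply: HMM.
Qed.

End Ideals.

Section Finiteness.
Context (k : closedFieldType) (N : nat).
Local Notation S := {mpoly k[N]}.
Local Notation ev y := (mmap (@mpolyC N k) y).
Implicit Types (P : S -> Prop) (p a : S).

(** [k[x] / P] is generated by [g] as a module, not just as an algebra, over [k[y_1, ..., y_d]]. *)
Definition fingen d (y : 'I_d -> S) P (J : finType) (g : J -> S) :=
  forall p, exists q : J -> {mpoly k[d]}, P (p - \sum_j ev y (q j) * g j).

Lemma fingen_enum d (y : 'I_d -> S) P (J : finType) (g : J -> S) :
  fingen y P g -> fingen y P (fun i : 'I_#|J| => g (enum_val i)).
Proof.
move=> Hg p; have [q Hq] := Hg p; exists (fun i : 'I_#|J| => q (enum_val i)).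
by rewrite (reindex (@enum_val J predT)) in Hq => //; exact: (onW_bij _ (enum_val_bij J)).
Qed.

Lemma fingen_sub d (y : 'I_d -> S) P P' (J : finType) (g : J -> S) :
  (forall p, P p -> P' p) -> fingen y P g -> fingen y P' g.
Proof. by move=> PP' Hg p; have [q Hq] := Hg p; exists q; apply: PP'. Qed.

(** Cayley-Hamilton modulo [P]: the determinant of [a - Q] annihilates every generator, hence the
    class of [1]. *)
Lemma determinant_trick d (y : 'I_d -> S) P t (g : 'I_t -> S) a (Q : 'M[{mpoly k[d]}]_t) :
  pideal P -> fingen y P g ->
  (forall l, P (a * g l - \sum_j ev y (Q l j) * g j)) ->
  P (map_poly (ev y) (char_poly Q)).[a].
Proof.
move=> HP Hg HQ; pose M := a%:M - map_mx (ev y) Q.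
have -> : (map_poly (ev y) (char_poly Q)).[a] = \det M.
  rewrite map_char_poly /char_poly -[LHS]/(horner_eval a _) -det_map_mx; congr (\det _).
  by apply/matrixP => i j; rewrite !mxE /= /horner_eval hornerD hornerN hornerC hornerMn hornerX.
pose v := \col_l g l.
have Pv l : P ((M *m v) l 0).
  suff -> : (M *m v) l 0 = a * g l - \sum_j ev y (Q l j) * g j by [].
  rewrite mulmxBl mul_scalar_mx !mxE; congr (_ - _).
  by apply: eq_bigr => j _; rewrite !mxE.
have Pg l : P (\det M * g l).
  have -> : \det M * g l = (\adj M *m (M *m v)) l 0.
    by rewrite mulmxA mul_adj_mx mul_scalar_mx !mxE.
  by rewrite mxE; apply: pideal_sum => // i _; apply: pidealM.
have [q Hq] := Hg 1; rewrite -[\det M]mulr1.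
apply: (pideal_iff HP (q := \det M * \sum_j ev y (q j) * g j)).
  by rewrite -mulrBr; apply: pidealM.
rewrite mulr_sumr; apply: pideal_sum => // j _; rewrite mulrCA; exact: pidealM.
Qed.

Lemma fingen_matrix d (y : 'I_d -> S) P t (g : 'I_t -> S) a : fingen y P g ->
  exists Q : 'M[{mpoly k[d]}]_t, forall l, P (a * g l - \sum_j ev y (Q l j) * g j).
Proof.
move=> Hg; pose q l := epsilon (inhabits (fun _ => 0))
  (fun q : 'I_t -> {mpoly k[d]} => P (a * g l - \sum_j ev y (q j) * g j)).
have Hq l : P (a * g l - \sum_j ev y (q l j) * g j).
  exact: (epsilon_spec (inhabits (fun _ => 0))
    (fun q : 'I_t -> {mpoly k[d]} => P (a * g l - \sum_j ev y (q j) * g j)) (Hg _)).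
by exists (\matrix_(l, j) q l j) => l; under eq_bigr do rewrite mxE.
Qed.

Lemma ev_cong d (y : 'I_d -> S) P (tau : 'I_d -> k) : pideal P ->
  (forall i, P (y i - (tau i)%:MP)) -> forall u, P (ev y u - (u.@[tau])%:MP).
Proof.
move=> HP Hy u.
have KM p q p' q' : P (p - q) -> P (p' - q') -> P (p * p' - q * q').
  move=> H H'; have -> : p * p' - q * q' = p * (p' - q') + q' * (p - q) by ring.
  by case: (HP) => _ HD _; apply: HD; apply: pidealM.
have P00 p : P (p - p) by rewrite subrr; case: HP.
rewrite /mmap mevalE raddf_sum /= -sumrB; apply: pideal_sum => // m _.
rewrite mpolyCM; apply: (KM) => //; rewrite /mmap1 rmorph_prod /=.
apply: (big_ind2 (fun p q => P (p - q))) => // i _; rewrite rmorphXn /=.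
elim: (m i) => [|e IH]; first by rewrite !expr0.
by rewrite !exprS; apply: KM.
Qed.

Lemma horner_cong d (y : 'I_d -> S) P (tau : 'I_d -> k) (chi : {poly {mpoly k[d]}}) a :
  pideal P -> (forall u, P (ev y u - (u.@[tau])%:MP)) ->
  P (map_poly (ev y) chi).[a] ->
  P (map_poly (@mpolyC N k) (map_poly (meval tau) chi)).[a].
Proof.
move=> HP Hc; apply: (pideal_iff HP).
rewrite -map_poly_comp_id0 ?meval0 ?rmorph0 //.
have E (f : {mpoly k[d]} -> S) : f 0 = 0 -> (map_poly f chi).[a] = \sum_(i < size chi) f chi`_i * a ^+ i.
  move=> f0; rewrite (@horner_coef_wide _ (size chi)); last by rewrite size_poly.
  by apply: eq_bigr => i _; rewrite coef_map_id0.
rewrite !E ?rmorph0 //= ?meval0 ?rmorph0 // -sumrB; apply: pideal_sum => // i _.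
rewrite -mulrBl mulrC; apply: pidealM => //; rewrite -opprB; exact: pidealN.
Qed.

(** The prime of [k[y]] to be lifted is given as the kernel of [sigma]. Its extension [J] contracts
    back to it: an element of [J] acts on the generators by a matrix with entries in the kernel,
    whose characteristic polynomial becomes a power of ['X] under [sigma]. A prime containing [J]
    and avoiding the image of the complement then lies exactly over the kernel. *)
Lemma going_up d (y : 'I_d -> S) P t (g : 'I_t -> S) (E : idomainType)
    (sigma : {rmorphism {mpoly k[d]} -> E}) :
  pideal P -> fingen y P g -> (forall u, P (ev y u) -> sigma u = 0) ->
  exists P', [/\ pprime P', forall p, P p -> P' p & forall u, P' (ev y u) <-> sigma u = 0].
Proof.
move=> HP Hg Hs.
pose J p := exists2 u : 'I_t -> {mpoly k[d]}, forall j, sigma (u j) = 0 &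
  P (p - \sum_j ev y (u j) * g j).
have PJ p : P p -> J p.
  move=> Pp; exists (fun _ => 0) => [j|]; first by rewrite rmorph0.
  by rewrite big1 ?subr0 // => j _; rewrite mmap0 mul0r.
have JD p q : J p -> J q -> J (p + q).
  move=> [u u0 Hu] [v v0 Hv]; exists (fun j => u j + v j) => [j|].
    by rewrite rmorphD u0 v0 addr0.
  under eq_bigr do rewrite rmorphD mulrDl.
  by rewrite big_split /= opprD addrACA; case: (HP) => _ HD _; apply: HD.
have Jg u l : sigma u = 0 -> forall p, J (p * (ev y u * g l)).
  move=> u0 p; have [q Hq] := Hg (p * g l); exists (fun j => u * q j) => [j|].
    by rewrite rmorphM u0 mul0r.
  under eq_bigr do rewrite rmorphM -mulrA.
  by rewrite -mulr_sumr mulrCA -mulrBr; apply: pidealM.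
have HJ : pideal J.
  split=> //; first by apply: (PJ); case: HP.
  move=> p q [u u0 Hu].
  have -> : p * q = p * (q - \sum_j ev y (u j) * g j) + \sum_j p * (ev y (u j) * g j).
    by rewrite -mulr_sumr -mulrDr subrK.
  apply: (JD); first by apply: (PJ); apply: pidealM.
  by apply: (big_ind J) => [|//|j _]; [by apply: (PJ); case: HP | exact: (Jg _ _ (u0 j))].
have Js u : J (ev y u) -> sigma u = 0.
  move=> Ju.
  have HQ l : exists w : 'I_t -> {mpoly k[d]}, (forall j, sigma (w j) = 0) /\
      P (ev y u * g l - \sum_j ev y (w j) * g j).
    by have [w w0 Hw] : J (ev y u * g l); [rewrite mulrC; apply: pidealM | exists w].
  pose q l := epsilon (inhabits (fun _ => 0)) (fun w : 'I_t -> {mpoly k[d]} =>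
     (forall j, sigma (w j) = 0) /\ P (ev y u * g l - \sum_j ev y (w j) * g j)).
  have Hq l : (forall j, sigma (q l j) = 0) /\ P (ev y u * g l - \sum_j ev y (q l j) * g j).
    exact: (epsilon_spec (inhabits (fun _ => 0)) (fun w : 'I_t -> {mpoly k[d]} =>
     (forall j, sigma (w j) = 0) /\ P (ev y u * g l - \sum_j ev y (w j) * g j)) (HQ l)).
  pose Q := \matrix_(l, j) q l j.
  have : P (map_poly (ev y) (char_poly Q)).[ev y u].
    apply: (determinant_trick HP Hg) => l; under eq_bigr do rewrite mxE.
    by case: (Hq l).
  rewrite horner_map => /Hs; rewrite -horner_map map_char_poly.
  have -> : map_mx sigma Q = 0 by apply/matrixP => l j; rewrite !mxE; case: (Hq l).
  have -> : char_poly (0 : 'M[E]_t) = 'X^t.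
    by rewrite /char_poly /char_poly_mx map_mx0 subr0 det_scalar.
  by rewrite hornerXn => /eqP; rewrite expf_eq0 => /andP[_ /eqP].
have [|p q [u [-> u0]] [v [-> v0]]|p Jp [u [Eu u0]]|P' [Pr JP' PT]] :=
  @exists_prime_avoiding _ J (fun p => exists u, p = ev y u /\ sigma u <> 0) HJ.
- by exists 1; rewrite rmorph1 rmorph1; split=> // /eqP; rewrite oner_eq0.
- exists (u * v); rewrite !rmorphM; split=> // /eqP; rewrite mulf_eq0.
  by case/orP => /eqP.
- by apply: u0; apply: Js; rewrite -Eu.
exists P'; split=> // [p /PJ /JP' //|u]; split=> [Hu|u0].
  by apply: NNPP => u0; apply: (PT _ Hu); exists u.
apply: JP'; have [q Hq] := Hg 1; exists (fun j => u * q j) => [j|].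
  by rewrite rmorphM u0 mul0r.
under eq_bigr do rewrite rmorphM -mulrA.
by rewrite -mulr_sumr -{1}[ev y u]mulr1 -mulrBr; apply: pidealM.
Qed.

(** Points are lifted from the [d]-dimensional affine space. Some multiple of [f] is congruent to
    [ev y c] with [c] outside the kernel; a zero [tau] of the kernel with [c(tau) <> 0] lifts to a
    prime [P'] with residue field [k], that is, to a point. There [f] cannot vanish, because
    [c(tau)] does not. *)
Lemma nullstellensatz d (y : 'I_d -> S) P t (g : 'I_t -> S) (E : idomainType)
    (sigma : {rmorphism {mpoly k[d]} -> E}) :
  pprime P -> fingen y P g -> (forall u, P (ev y u) <-> sigma u = 0) ->
  (forall u, sigma u <> 0 -> exists2 tau, u.@[tau] != 0 & forall w, sigma w = 0 -> w.@[tau] = 0) ->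
  forall f, ~ P f -> exists2 x : point k N, forall p, P p -> p.@[x] = 0 & f.@[x] != 0.
Proof.
move=> Pr Hg Hs Hd f Pf; case: (Pr) => HP P1 PM.
(* The characteristic equation of [f] is divided by [f] as long as its constant coefficient is in
   the kernel, which is allowed since [P] is prime and omits [f]; the leading coefficient [1] makes
   this stop. *)
have [c [w [Hc Pc]]] : exists c w, sigma c <> 0 /\ P (ev y c - w * f).
  have [Q HQ] := fingen_matrix f Hg.
  have := determinant_trick HP Hg HQ; set chi := char_poly Q => Hchi.
  have Mchi : chi \is monic by apply: char_poly_monic.
  have : forall chi : {poly {mpoly k[d]}}, (exists i, sigma chi`_i <> 0) ->
     P (map_poly (ev y) chi).[f] -> exists c w, sigma c <> 0 /\ P (ev y c - w * f).
    elim/poly_ind => [[i]|q c IH [i Hi]]; first by rewrite coef0 rmorph0.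
    rewrite rmorphD rmorphM /= map_polyX map_polyC hornerD hornerM hornerX hornerC => H.
    have [c0|c0] := classic (sigma c = 0); last first.
      exists c, (- (map_poly (ev y) q).[f]); split=> //.
      by rewrite mulNr opprK addrC.
    apply: IH; first by case: i Hi => [|i]; rewrite coefD coefMX coefC /= ?add0r ?addr0 // => Hi; exists i.
    have /PM[//|//] : P ((map_poly (ev y) q).[f] * f).
    by rewrite -[_ * f](addrK (ev y c)); apply: (pidealB HP H); apply/Hs.
  apply; last exact: Hchi.
  exists (size chi).-1; rewrite -lead_coefE (monicP Mchi) rmorph1; apply/eqP; exact: oner_neq0.
have [tau ctau Htau] := Hd _ Hc.
have [|P' [Pr' PP' Hs']] := going_up (sigma := meval tau) HP Hg.
  by move=> u /Hs; apply: Htau.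
case: (Pr') => HP' P1' PM'.
have cong u : P' (ev y u - (u.@[tau])%:MP).
  have -> : ev y u - (u.@[tau])%:MP = ev y (u - (u.@[tau])%:MP) by rewrite rmorphB /= mmapC.
  by apply/Hs'; rewrite /= mevalB mevalC subrr.
(* Modulo [P'] the characteristic equation of [a] has coefficients in [k] and splits; the prime [P']
   contains one of the linear factors. *)
have val a : exists z : k, P' (a - z%:MP).
  have [Q HQ] := fingen_matrix a Hg.
  have := horner_cong HP' cong (PP' _ (determinant_trick HP Hg HQ)).
  rewrite map_char_poly; set chi := char_poly _.
  have [r Er] := closed_field_poly_normal chi.
  have -> : (map_poly (@mpolyC N k) chi).[a] = \prod_(z <- r) (a - z%:MP).
    rewrite Er (monicP (char_poly_monic _)) scale1r rmorph_prod horner_prod.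
    by apply: eq_bigr => z _; rewrite rmorphB /= map_polyX map_polyC !hornerE.
  by move/(pprime_prod Pr')=> [z Hz]; exists z.
pose x i := epsilon (inhabits 0) (fun z : k => P' ('X_i - z%:MP)).
have Hx i : P' ('X_i - (x i)%:MP).
  exact: (epsilon_spec (inhabits 0) (fun z : k => P' ('X_i - z%:MP)) (val _)).
have Hcong p : P' (p - (p.@[x])%:MP).
  have := ev_cong HP' Hx p.
  rewrite (_ : ev _ p = p) //.
  rewrite [RHS]mpolyE /mmap; apply: eq_bigr => m _.
  by rewrite mmap1_id mul_mpolyC.
have zero p : P' p -> p.@[x] = 0.
  move=> Pp; apply/eqP/negPn/negP => px; apply: P1'.
  have -> : 1 = ((p.@[x])^-1)%:MP * (p - (p - (p.@[x])%:MP)) :> S.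
    by rewrite opprB addrC subrK -mpolyCM mulVf.
  by apply: pidealM => //; apply: pidealB.
exists x => [p /PP' /zero //|].
apply: contra ctau => /eqP fx.
have := zero _ (cong c); rewrite mevalB mevalC => /eqP; rewrite subr_eq0 => /eqP <-.
have := zero _ (PP' _ Pc); rewrite mevalB mevalM fx mulr0 subr0 => ->; exact: eqxx.
Qed.

End Finiteness.

(** * Noether normalization and parameters *)

Section Noether.
Context (k : closedFieldType) (N : nat).
Local Notation S := {mpoly k[N]}.
Local Notation ev y := (mmap (@mpolyC N k) y).
Implicit Types (P : S -> Prop) (p a : S).

(* Nagata's change of variables: the exponents [B^i] give distinct weights to the
   monomials of [q], so that [q] becomes monic in [y_0] over [k[z]]. *)
Lemma noether_step d (y : 'I_d.+1 -> S) P t (g : 'I_t -> S) (q : {mpoly k[d.+1]}) :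
  pideal P -> fingen y P g -> q != 0 -> P (ev y q) ->
  exists (z : 'I_d -> S) t' (g' : 'I_t' -> S), fingen z P g'.
Proof.
move=> HP Hg q0 Pq; pose B := msize q; pose w := y ord0.
pose z (i : 'I_d) := y (lift ord0 i) - w ^+ (B ^ lift ord0 i).
pose G (j : 'I_d.+1) : {poly {mpoly k[d]}} :=
  if unlift ord0 j is Some i then 'X^(B ^ j) + ('X_i)%:P else 'X.
have B0 : (0 < B)%N by rewrite lt0n msize_poly_eq0.
have GX i : (G i \is monic) /\ size (G i) = (B ^ i).+1.
  rewrite /G; case: unliftP => [i' _|->]; last by rewrite monicX size_polyX expn0.
  have lt : (size ('X_i' : {mpoly k[d]})%:P < size ('X^(B ^ i) : {poly {mpoly k[d]}}))%N.
    by rewrite size_polyXn (leq_ltn_trans (size_polyC_leq1 _)) // ltnS expn_gt0 B0.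
  by rewrite monicE lead_coefDl // lead_coefXn eqxx size_polyDl // size_polyXn.
have [||W [c [c0 HW Hc]]] := @weighted_lead k _ (@mpolyC d k) d.+1 B G _ _ q q0 (erefl _).
- by move=> i; case: (GX i).
- by move=> i; case: (GX i).
pose Gm := mmap (polyC \o @mpolyC d k) G.
pose Ev (h : {poly {mpoly k[d]}}) : S := (map_poly (ev z) h).[w].
have EvG u : Ev (Gm u) = ev y u.
  rewrite /Ev /Gm [mmap (_ \o _) G u]/mmap [RHS]/mmap rmorph_sum horner_sum; apply: eq_bigr => m _.
  rewrite rmorphM hornerM /= map_polyC hornerC /= mmapC; congr (_ * _).
  rewrite /mmap1 rmorph_prod horner_prod; apply: eq_bigr => i _.
  rewrite rmorphXn horner_exp; congr (_ ^+ _); rewrite /G.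
  case: unliftP => [i' Ei|->]; last by rewrite /= map_polyX hornerX.
  rewrite rmorphD rmorphXn /= map_polyX map_polyC hornerD hornerXn hornerC /=.
  by rewrite mmapX mmap1U /z Ei addrC subrK.
pose H := (c^-1)%:MP *: Gm q.
have cc : (c^-1)%:MP * c%:MP = 1 :> {mpoly k[d]} by rewrite -mpolyCM mulVf.
have cW : H`_W = 1 by rewrite coefZ Hc.
have sH : size H = W.+1.
  apply/anti_leq/andP; split; first exact: leq_trans (size_scale_leq _ _) HW.
  by rewrite ltnNge; apply/negP => le; move: cW; rewrite nth_default // => /eqP; rewrite eq_sym oner_eq0.
have Hmonic : H \is monic by rewrite monicE lead_coefE sH cW.
have PH : P (Ev H).
  rewrite /Ev linearZ /= hornerZ -/(Ev _) EvG; exact: pidealM.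
exists z; exists #|{: 'I_t * 'I_W}|, (fun l =>
  let lj : 'I_t * 'I_W := enum_val l in g lj.1 * w ^+ lj.2).
apply: (@fingen_enum _ _ _ _ _ _ (fun l : 'I_t * 'I_W => g l.1 * w ^+ l.2)) => p.
have [u Hu] := Hg p.
(* Modulo [P], division by the monic [H] leaves degree below [W] in [w], so the [g l * w ^+ j] with
   [j < W] generate over [k[z]]. *)
pose R l := Pdiv.CommonRing.rmodp (Gm (u l)) H.
exists (fun lj : 'I_t * 'I_W => (R lj.1)`_lj.2).
apply: (pideal_iff HP (q := \sum_l ev y (u l) * g l - \sum_(lj : 'I_t * 'I_W) ev z (R lj.1)`_lj.2 * (g lj.1 * w ^+ lj.2))).
  by rewrite opprB addrA subrK.
have -> : \sum_(lj : 'I_t * 'I_W) ev z (R lj.1)`_lj.2 * (g lj.1 * w ^+ lj.2)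
    = \sum_l Ev (R l) * g l.
  rewrite -(pair_big predT predT (fun l (j : 'I_W) => ev z (R l)`_j * (g l * w ^+ j))) /=.
  apply: eq_bigr => l _; rewrite /Ev (@horner_coef_wide _ W).
    by rewrite mulr_suml; apply: eq_bigr => j _; rewrite coef_map /= mulrCA mulrC.
  apply: leq_trans (size_poly _ _) _; rewrite -ltnS -sH.
  by apply: Pdiv.CommonRing.ltn_rmodpN0; apply: monic_neq0.
rewrite -sumrB; apply: pideal_sum => // l _; rewrite -mulrBl mulrC; apply: pidealM => //.
rewrite -EvG {1}(Pdiv.RingMonic.rdivp_eq Hmonic (Gm (u l))) {1}/Ev rmorphD rmorphM hornerD hornerM.
by rewrite -/(Ev _) -/(Ev H) -/(Ev _) addrK; apply: pidealM.
Qed.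

Lemma noether_normalization P : pideal P -> ~ P 1 ->
  exists d (y : 'I_d -> S) t (g : 'I_t -> S), fingen y P g /\ forall u, P (ev y u) -> u = 0.
Proof.
move=> HP P1.
have : exists d (y : 'I_d -> S) t (g : 'I_t -> S), fingen y P g.
  exists N, (fun i => 'X_i), 1%N, (fun _ => 1) => p; exists (fun _ => p).
  rewrite big_ord_recl big_ord0 addr0 mulr1 (_ : ev _ p = p) ?subrr; first by case: HP.
  rewrite [RHS]mpolyE /mmap; apply: eq_bigr => m _.
  by rewrite mmap1_id mul_mpolyC.
case=> d; elim: d => [|d IH] [y [t [g Hg]]].
  exists 0%N, y, t, g; split=> // u Pu; apply/eqP/negPn/negP => u0; apply: P1.
  have E : u = (u@_0)%:MP.
    apply/mpolyP => m; rewrite mcoeffC (_ : m = 0%MM) ?eqxx ?mulr1 //.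
    by apply/mnmP => -[].
  have c0 : u@_0 != 0 by apply: contra u0 => /eqP c0; rewrite E c0 mpolyC0.
  have -> : 1 = ((u@_0)^-1)%:MP * ev y u by rewrite {2}E mmapC -mpolyCM mulVf.
  exact: pidealM.
have [Hi|Hi] := classic (forall u, P (ev y u) -> u = 0); first by exists d.+1, y, t, g.
apply: IH; have [u Hu] := not_all_ex_not _ _ Hi.
have [Pu /eqP u0] := imply_to_and _ _ Hu.
exact: noether_step HP Hg u0 Pu.
Qed.

End Noether.

(** * Irreducible components, chains and parameters at the origin *)

Section Geometry.
Context (k : closedFieldType) (N : nat).
Local Notation S := {mpoly k[N]}.
Local Notation ev y := (mmap (@mpolyC N k) y).
Implicit Types (P : S -> Prop) (p a : S) (X Y Z : aset k N).

Lemma vanish_pideal X : pideal (@vanish k N X).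
Proof. split; [exact: vanish0 | exact: vanishD | exact: vanishM]. Qed.

Definition zeros P : aset k N := fun x => forall p, P p -> p.@[x] = 0.

Lemma zeros_irreducible P : pprime P ->
  (forall f, ~ P f -> exists2 x, zeros P x & f.@[x] != 0) -> irreducible (zeros P).
Proof.
move=> [_ P1 PM] Hn; split; first by exists P.
split; first by have [x Hx _] := Hn _ P1; exists x.
move=> Z1 Z2 [S1 H1] [S2 H2] sub; apply: NNPP => /not_or_and[N1 N2].
have outside Z (T : S -> Prop) : (forall x, Z x <-> forall p, T p -> p.@[x] = 0) ->
    ~ asubset (zeros P) Z -> exists2 p, T p & ~ P p.
  move=> HZ NZ; apply: NNPP => Hp; apply: NZ => x Px; apply/HZ => p Tp.
  by apply: Px; apply: NNPP => NP; apply: Hp; exists p.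
have [p1 T1 NP1] := outside _ _ H1 N1; have [p2 T2 NP2] := outside _ _ H2 N2.
have [|x Px] := Hn (p1 * p2); first by case/PM.
rewrite mevalM mulf_eq0 negb_or => /andP[x1 x2].
by case: (sub x Px) => [/H1/(_ _ T1)|/H2/(_ _ T2)] E; rewrite E eqxx in x1 x2.
Qed.

(** A union of a chain of closed sets need not be closed, so Zorn's lemma is applied to the
    irreducibility property without closedness; the Zariski closure of a maximal set is the
    component. *)
Lemma exists_component X Y : zclosed X -> irreducible Y -> asubset Y X ->
  exists2 Y', irr_component X Y' & asubset Y Y'.
Proof.
move=> ZX [_ [[x0 Yx0] irrY]] YX.
pose irr (A : aset k N) := asubset A X /\ forall Z1 Z2, zclosed Z1 -> zclosed Z2 ->
  asubset A (fun x => Z1 x \/ Z2 x) -> asubset A Z1 \/ asubset A Z2.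
have [|F _ FP tot|A [[AX irrA] YA maxA]] := @zorn_pred _ irr Y x0 Yx0.
- by [].
- split; first by move=> x [A FA Ax]; case: (FP A FA) => H _; apply: H.
  move=> Z1 Z2 C1 C2 sub.
  have subA A : F A -> asubset A (fun x => Z1 x \/ Z2 x).
    by move=> FA x Ax; apply: sub; exists A.
  have [H|H] := classic (forall A, F A -> asubset A Z1).
    by left => x [A FA]; apply: H.
  right => x [A FA Ax].
  have [B HB] := not_all_ex_not _ _ H; have [FB NB] := imply_to_and _ _ HB.
  have big C : F C -> asubset B C -> asubset C Z2.
    move=> FC BC; case: (FP C FC) => _ /(_ _ _ C1 C2 (subA _ FC))[H1|//].
    by case: NB => y By; apply: H1; apply: BC.
  have [AB|BA] := tot A B FA FB; first by apply: (big B) => //; apply: AB.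
  exact: (big A).
pose cl := zeros (vanish A).
have Acl : asubset A cl by move=> x Ax p; apply.
have clmin Z : zclosed Z -> asubset A Z -> asubset cl Z.
  by move=> [T HT] AZ x clx; apply/HT => p Tp; apply: clx => y /AZ/HT; apply.
have irrcl Z1 Z2 : zclosed Z1 -> zclosed Z2 ->
    asubset cl (fun x => Z1 x \/ Z2 x) -> asubset cl Z1 \/ asubset cl Z2.
  move=> C1 C2 sub; have [x /Acl/sub //|H|H] := irrA _ _ C1 C2.
    by left; apply: clmin.
  by right; apply: clmin.
exists cl; last by move=> x /YA /Acl.
split; first by split; [exists (vanish A) | split=> //; exists x0; apply/Acl/YA].
split; first exact: clmin.
move=> Y' [_ [_ irrY']] clY' Y'X x Y'x; apply: (Acl).
by apply: (maxA Y') => //; move=> y /Acl /clY'.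
Qed.

(** The kernels, generated by the first [i] variables, are primes that increase strictly up to
    [i = d]. *)
Definition cut d i : {mpoly k[d]} -> {mpoly k[d]} :=
  mmap (@mpolyC d k) (fun l : 'I_d => if (l < i)%N then 0 else 'X_l).

HB.instance Definition _ d i := GRing.RMorphism.copy (@cut d i)
  (mmap (@mpolyC d k) (fun l : 'I_d => if (l < i)%N then 0 else 'X_l)).

Lemma meval_cut d i (tau : 'I_d -> k) u :
  (cut i u).@[tau] = u.@[fun l => if (l < i)%N then 0 else tau l].
Proof.
rewrite /cut /mmap raddf_sum mevalE; apply: eq_bigr => m _ /=.
rewrite mevalM mevalC; congr (_ * _); rewrite /mmap1 rmorph_prod; apply: eq_bigr => l _ /=.
by rewrite rmorphXn /=; case: ifP => _; rewrite ?meval0 ?mevalXU.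
Qed.

Lemma cut_cut d i u : cut i.+1 (@cut d i u) = cut i.+1 u.
Proof.
rewrite {2}/cut /mmap raddf_sum /= [RHS]/cut /mmap; apply: eq_bigr => m _ /=.
rewrite rmorphM /= {1}/cut mmapC; congr (_ * _); rewrite /mmap1 rmorph_prod; apply: eq_bigr => l _ /=.
rewrite rmorphXn /=; congr (_ ^+ _).
case: ltnP => [lt|ge]; first by rewrite (ltn_trans lt) // /cut mmap0.
by rewrite /cut mmapX mmap1U.
Qed.

(** The kernels of the [cut i] are lifted successively by [going_up]. The variable of index [i]
    separates two consecutive primes, and [nullstellensatz] turns this into a strict inclusion of
    their zero sets. *)
Lemma irreducible_chain X d (y : 'I_d -> S) t (g : 'I_t -> S) : zclosed X ->
  fingen y (vanish X) g -> (forall u, vanish X (ev y u) -> u = 0) ->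
  exists V : nat -> aset k N, [/\ forall i, irreducible (V i), forall i, asubset (V i) X,
    forall i, asubset (V i.+1) (V i) & forall i, (i < d)%N -> ~ asubset (V i) (V i.+1)].
Proof.
move=> [T HT] Hg Hi.
pose good i P := pprime P /\ forall u, P (ev y u) <-> cut i u = 0.
have step i P : good i P -> (forall p, vanish X p -> P p) ->
    exists P', good i.+1 P' /\ forall p, P p -> P' p.
  move=> [Pr HP] VP; case: (Pr) => Pi _ _.
  have [u /HP Hu|P' [Pr' PP' HP']] := @going_up _ _ _ _ P _ _ _ (cut i.+1) Pi (fingen_sub VP Hg).
    by rewrite /= -cut_cut Hu; apply: mmap0.
  by exists P'.
have [u /Hi ->|P0 [Pr0 VP0 HP0]] := @going_up _ _ _ _ _ _ _ _ (cut 0) (vanish_pideal X) Hg.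
  exact: rmorph0.
pose next i P := epsilon (inhabits (fun _ => True)) (fun P' => good i.+1 P' /\ forall p, P p -> P' p).
pose F := fix F i := if i is j.+1 then next j (F j) else P0.
have HF i : good i (F i) /\ forall p, vanish X p -> F i p.
  have nextP j P : (exists P', good j.+1 P' /\ forall p, P p -> P' p) ->
      good j.+1 (next j P) /\ forall p, P p -> next j P p.
    exact: (epsilon_spec (inhabits (fun _ => True)) (fun P' => good j.+1 P' /\ forall p, P p -> P' p)).
  elim: i => [|i [gi Vi]]; first by [].
  have [g1 s1] := nextP i (F i) (step i _ gi Vi).
  by split=> // p /Vi /s1.
have FS i p : F i p -> F i.+1 p.
  move=> Fp; have [gi Vi] := HF i.
  exact: (proj2 (epsilon_spec (inhabits (fun _ => True)) (fun P' => good i.+1 P' /\ forall p, F i p -> P' p) (step i _ gi Vi))).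
have null i f : ~ F i f -> exists2 x, zeros (F i) x & f.@[x] != 0.
  have [[Pr HP] Vi] := HF i.
  apply: (nullstellensatz (sigma := cut i) Pr (fingen_sub Vi Hg) HP) => u /eqP /mpoly_nonroot[tau].
  rewrite meval_cut => Htau; exists (fun l : 'I_d => if (l < i)%N then 0 else tau l) => // w Hw.
  by rewrite -meval_cut Hw meval0.
exists (fun i => zeros (F i)); split.
- by move=> i; apply: zeros_irreducible; [case: (HF i) => -[] | apply: null].
- by move=> i x Hx; apply/HT => p Tp; apply: Hx; case: (HF i) => _; apply => z /HT; apply.
- by move=> i x Hx p /FS; apply: Hx.
move=> i lt sub.
pose T0 : {mpoly k[d]} := 'X_(Ordinal lt).
have NF : ~ F i (ev y T0).
  case: (HF i) => -[_ HP] _ /HP; rewrite /cut mmapX mmap1U /= ltnn => /eqP.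
  by rewrite -msupp_eq0 msuppX.
have [x Hx /eqP[]] := null _ _ NF; apply: (sub x Hx).
by case: (HF i.+1) => -[_ HP] _; apply/HP; rewrite /cut mmapX mmap1U /= ltnSn.
Qed.

Lemma noether_dim X n d (y : 'I_d -> S) t (g : 'I_t -> S) : equidim_variety_at0 X n ->
  fingen y (vanish X) g -> (forall u, vanish X (ev y u) -> u = 0) -> (d <= n)%N.
Proof.
move=> [ZX [_ dimX]] Hg Hi; rewrite leqNgt; apply/negP => lt.
have [V [irrV VX VS Vneq]] := irreducible_chain ZX Hg Hi.
have [Y HY VY] := exists_component ZX (irrV 0%N) (VX 0%N).
have [_ nochain] := dimX _ HY; apply: nochain.
have V0 i : asubset (V i) Y by elim: i => [|i IH] // x /VS /IH.
(* [V] decreases while [irr_chain] increases, hence the reversed index; strictness concerns indices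
   at most [n], which are below [d]. *)
exists (fun i => V (n.+1 - i)%N); split=> i Hi'; first by split.
rewrite -(subnSK Hi'); split; first exact: VS.
by apply: Vneq; apply: leq_ltn_trans lt; rewrite subSS leq_subr.
Qed.

(** Each coordinate is integral over [k[y]], and modulo the [y_i - y_i(o)] its equation has
    coefficients in [k]. Written as ['X^a * q] with [q(0) <> 0], it shows that a power of the
    coordinate lies in the ideal, since [q] at the coordinate is a unit at [o]. For [d < n] the
    system is padded with zeros. *)
Lemma exists_parameters X n : equidim_variety_at0 X n ->
  exists f : 'I_n -> S, isol X f /\ forall i, (f i).@[@origin k N] = 0.
Proof.
move=> HX; case: (HX) => ZX [X0 _].
have V1 : ~ vanish X 1 by move=> /(_ _ X0)/eqP; rewrite meval1 oner_eq0.
have [d [y [t [g [Hg Hi]]]]] := noether_normalization (vanish_pideal X) V1.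
have dn := noether_dim HX Hg Hi.
pose tau i := (y i).@[@origin k N].
pose f (j : 'I_n) : S := if insub (val j) is Some i then y i - (tau i)%:MP else 0.
have f0 j : (f j).@[@origin k N] = 0.
  by rewrite /f; case: insubP => [i _ _|_]; rewrite ?meval0 // mevalB mevalC subrr.
exists f; split=> //.
have L := lpow_lideal X f 1.
have HP : pideal (lpow X f 1).
  by case: (L) => H1 H2 H3 _; split=> //; apply: H1; apply: vanish0.
have Hy i : lpow X f 1 (y i - (tau i)%:MP).
  have -> : y i - (tau i)%:MP = f (widen_ord dn i) by rewrite /f /= insubT //= => H; congr (y _ - (tau _)%:MP); apply: val_inj.
  exact: lpow1.
have power (j : 'I_N) : exists e, lpow X f 1 ('X_j ^+ e).
  have [Q HQ] := fingen_matrix 'X_j Hg.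
  have V := determinant_trick (vanish_pideal X) Hg HQ.
  have := horner_cong HP (ev_cong HP Hy) (lidealV L V).
  rewrite map_char_poly; set chi := char_poly _.
  have chi0 : chi != 0 by apply/monic_neq0/char_poly_monic.
  have [a [q]] := multiplicity_XsubC chi 0; rewrite chi0 /= => q0 ->.
  rewrite subr0 rmorphM rmorphXn /= map_polyX hornerM hornerXn => H; exists a.
  apply: (lideal_unit L _ H); move: q0; rewrite /root.
  suff -> : (map_poly (@mpolyC N k) q).['X_j].@[@origin k N] = q.[0] by [].
  rewrite horner_coef0 (@horner_coef_wide _ (size q)) ?size_poly // raddf_sum /=.
  case Eq: (size q) => [|sq].
    by rewrite big_ord0 nth_default // Eq.
  rewrite big_ord_recl big1 ?addr0 => [|i _]; last first.
    by rewrite mevalM rmorphXn /= mevalXU expr0n /= mulr0.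
  by rewrite expr0 mulr1 coef_map /= mevalC.
pose a (j : 'I_N) := epsilon (inhabits 0%N) (fun e => lpow X f 1 ('X_j ^+ e)).
have Ha (j : 'I_N) : lpow X f 1 ('X_j ^+ a j).
  exact: (epsilon_spec (inhabits 0%N) (fun e => lpow X f 1 ('X_j ^+ e)) (power j)).
(* Above degree [N * K] every monomial in the coordinates has a factor ['X_j ^+ K]. *)
pose K := (\sum_j a j)%N.
exists (N * K).+1 => p /(lpow_frob (ltnSn _)).
apply: lpow_step => // j q _; apply: (lidealM _ L).
have le : (a j <= K)%N by rewrite /K (bigD1 j) //= leq_addr.
by rewrite -(subnK le) exprD; apply: (lidealM _ L).
Qed.

End Geometry.

(** * Minimal multiplicity on an open set *)

Lemma exists_system (k : closedFieldType) (N n : nat) (X : aset k N)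
  (HX : equidim_variety_at0 X n) (I : 'I_n -> germ k N -> Prop)
  (HI : forall i, mprimary X (I i)) :
  exists f : 'I_n -> {mpoly k[N]}, isol X f /\ forall i, I i (fpoly (f i)).
Proof.
case: (HX) => _ [X0 _].
have [f [Hf f0]] := exists_parameters HX.
pose s i := epsilon (inhabits 0%N) (fun s => forall p,
  lpow X (fun i : 'I_N => 'X_i) s p -> I i (fpoly p)).
have Hs i p : lpow X (fun i : 'I_N => 'X_i) (s i) p -> I i (fpoly p).
  exact: (epsilon_spec (inhabits 0%N) (fun s => forall p,
    lpow X (fun i : 'I_N => 'X_i) s p -> I i (fpoly p)) (mprimary_lpow X0 (HI i))).
(* A common exponent, at least every [s i], allows [isol_frob] to be applied. *)
exists (fun i => f i ^+ (\sum_j s j)); split; first exact: isol_frob.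
move=> i; apply: Hs; apply: (@lpow_decr _ _ _ _ _ _ (\sum_j s j)%N).
  by rewrite (bigD1 i) //= leq_addr.
by have := lpow_exp (\sum_j s j)%N (lpow_origin X (f0 i)); rewrite mul1n.
Qed.

Theorem theorem6p1 (k : closedFieldType) (N n : nat) (X : aset k N)
  (HX : equidim_variety_at0 X n)
  (I : 'I_n -> germ k N -> Prop)
  (HI : forall i, mprimary X (I i)) :
  exists m0 : nat, forall m : nat, (m0 <= m)%N -> (0 < m)%N ->
    exists U : ('I_n -> kpoly k N) -> Prop,
      zopen_in m (sys_space I m) U /\
      restr_saturated X (sys_space I m) U /\
      (exists f, U f) /\
      exists e : R,
        (* (1) o is an isolated root and the multiplicity is the same on U *)
        (forall f, U f -> isolated_root X f /\ mult_is X f e) /\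
        (* (2) e is the smallest multiplicity over all systems in
               I_1^(m) x ... x I_n^(m) having o as an isolated root *)
        (forall g, sys_space I m g -> isolated_root X g ->
           forall e' : R, mult_is X g e' -> Rle e e').
Proof.
case: (HX) => _ [X0 _].
have [f0 [iso0 If0]] := exists_system HX HI.
(* From this degree on, the space of systems contains [f0], so a minimum over isolated systems
   exists. *)
exists (\sum_i msize (f0 i))%N => m mm _.
have V0 : sys_space I m f0.
  move=> i; split=> //; apply: leqW; apply: leq_trans mm.
  by rewrite (bigD1 i) //= leq_addr.
pose good r := exists g C, [/\ sys_space I m g, isol X g, mult_is X g (INR r) &
  forall K L, (0 < K)%N -> codim (lpow X (fun i => g i ^+ K) 1) L ->
    (r * K ^ n <= L)%N /\ (K * L <= K * (r * K ^ n) + C * K ^ n)%N].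
have goodP g : sys_space I m g -> isol X g -> exists2 r, good r & mult_is X g (INR r) /\
    forall K L, (0 < K)%N -> codim (lpow X (fun i => g i ^+ K) 1) L -> (r * K ^ n <= L)%N.
  move=> Vg ig; have [r [C [H1 H2]]] := multiplicity ig.
  exists r; first by exists g, C.
  by split=> // K L K0 /(H2 _ _ K0)[].
have [r [g [C [Vg ig mg Hg]]] rmin] : exists2 r, good r & forall r', good r' -> (r <= r')%N.
  have [r Hr _] := goodP _ V0 iso0; elim/ltn_ind: r Hr => r IH Hr.
  have [[r' [lt Hr']]|H] := classic (exists r', (r' < r)%N /\ good r'); first exact: IH Hr'.
  exists r => // r' Hr'; rewrite leqNgt; apply/negP => lt; apply: H; by exists r'.
(* [K = C.+1] is the first exponent at which the error [C * K ^ n] is below [K * K ^ n], so that [L]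
   separates [r] from [r + 1]. *)
have [L HL] := codim_exists 1 (isol_frob C.+1 ig).
have [_ upL] := Hg C.+1 L isT HL.
have ltL : (L < r.+1 * C.+1 ^ n)%N.
  have p0 : (0 < C.+1 ^ n)%N by rewrite expn_gt0.
  rewrite -(ltn_pmul2l (m := C.+1)) //; apply: (leq_ltn_trans upL).
  by rewrite [(r.+1 * _)%N]mulSn mulnDr addnC ltn_add2r ltn_pmul2r.
have size_of f : sys_space I m f -> forall i, (msize (f i) <= m.+1)%N.
  by move=> Vf i; case: (Vf i).
have [h [hg hopen hsat]] := semicontinuity ig (size_of _ Vg) (ltn0Sn C) HL.
exists (fun f => sys_space I m f /\ h.@[@coords k N n m f] != 0).
split; first by exists [:: h] => f; rewrite /= orbF.
split.
  move=> f f' [Vf hf] Vf' E; split=> //.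
  by rewrite -(hsat f f' (size_of _ Vf) (size_of _ Vf') E).
split; first by exists g.
exists (INR r); split=> [f [Vf hf]|g' Vg' /(isolated_rootE X0) ig' e' He'].
  have [isof HLf] := hopen f (size_of _ Vf) hf.
  split; first exact/(isolated_rootE X0).
  have [r' /rmin ge [mf low]] := goodP f Vf isof.
  suff -> : r = r' by [].
  apply/anti_leq; rewrite ge /=.
  have [L' HL'] := codim_exists 1 (isol_frob C.+1 isof).
  (* With [K = C.+1], [r' * K ^ n <= L' <= L < r.+1 * K ^ n], hence [r' <= r]. *)
  have := leq_ltn_trans (leq_trans (low C.+1 L' isT HL') (HLf _ HL')) ltL.
  by rewrite ltn_pmul2r ?expn_gt0.
have [r' /rmin ge [mg' _]] := goodP g' Vg' ig'.
rewrite -(SeqProp.UL_sequence _ _ _ mg' He').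
by apply: RIneq.le_INR; apply/leP.
Qed.
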